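(* Let $\mathbb{G}$ be a homogeneous Lie group with a quasi-norm $|\cdot|$ and homogeneous dimension $Q$. Let $q\ge p_1$ and $q<p_2$ with $p_1,p_2,q>1$ (all finite) and $\frac1{r_2}=\frac1q-\frac1{p_2}$, and let $\alpha,\beta_1,\beta_2\in\mathbb{R}$. Then the inequality $$\left(\int_{\mathbb{G}}\left(H_2^B(|f_1|,|f_2|)(x)\right)^q|x|^{\alpha}\,dx\right)^{1/q}\le C\left(\int_{\mathbb{G}}|f_1(x)|^{p_1}|x|^{\beta_1}\,dx\right)^{1/p_1}\left(\int_{\mathbb{G}}|f_2(x)|^{p_2}|x|^{\beta_2}\,dx\right)^{1/p_2}$$ holds (with some finite constant $C$) for all measurable functions $f_1,f_2:\mathbb{G}\to\mathbb{C}$ if and only if $$\beta_1(1-p_1')+Q>0,\qquad \alpha+Q<0,\qquad \beta_2(1-p_2')+Q>0,$$ $$\frac{(\alpha+Q)r_2}{q}+\frac{(\beta_2(1-p_2')+Q)r_2}{q'}+\beta_2(1-p_2')+Q<0$$ and $$\frac{\alpha+Q}{q}+\frac{\beta_1(1-p_1')+Q}{p_1'}+\frac{\beta_2(1-p_2')+Q}{p_2'}=0 .$$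
   Context: Here $dx$ is the Haar measure on $\mathbb{G}$, $p'$ is the conjugate exponent, $\frac1p+\frac1{p'}=1$ (likewise $q'$), and the fixed point is the identity element $0$ of $\mathbb{G}$, with $B(0,r)=\{y\in\mathbb{G}:|y|<r\}$ the quasi-ball. For nonnegative measurable $g_1,g_2$ on $\mathbb{G}$, $$H_2^B(g_1,g_2)(x):=\int_{B(0,|x|)}g_1(y)\,dy\;\int_{B(0,|x|)}g_2(y)\,dy .$$ The polar decomposition on $\mathbb{G}$ has $\lambda(r,\omega)=r^{Q-1}$, i.e. $\int_{\mathbb{G}}g(x)\,dx=\int_0^\infty\int_{\{|\omega|=1\}}g(r,\omega)\,r^{Q-1}\,d\omega\,dr$. *)

(* Defs.v *)
From HB Require Import structures.
From mathcomp Require Import all_boot all_order all_algebra.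
From mathcomp Require Import complex.
From mathcomp Require Import all_classical all_reals all_analysis.

Set Implicit Arguments.
Unset Strict Implicit.
Unset Printing Implicit Defensive.

Import Order.TTheory GRing.Theory Num.Theory.
Import numFieldNormedType.Exports.

Local Open Scope classical_set_scope.
Local Open Scope ring_scope.

(* C^k and C^oo maps between finite-dimensional normed spaces, through iterated
   directional derivatives. *)
Fixpoint Ck (R : realType) (V W : normedModType R) (k : nat) (f : V -> W) :
    Prop :=
  if k is k'.+1 then
    continuous f /\
    forall v : V, (forall x, derivable f x v) /\ Ck k' (fun x => 'D_v f x)
  else continuous f.

Definition smooth (R : realType) (V W : normedModType R) (f : V -> W) : Prop :=
  forall k, Ck k f.

Definition anisotropic_dilation (R : realType) (n : nat) (nu : 'I_n -> R)
    (r : R) (x : 'rV[R]_n) : 'rV[R]_n :=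
  \row_i (r `^ (nu i) * x ord0 i).

(* A homogeneous Lie group, realised as usual on R^n: a Lie group law on R^n
   for which the dilations (x_i) |-> (r^(nu_i) x_i), r > 0, with positive
   weights nu_i are group automorphisms.  They fix the identity element, which
   is therefore the origin. *)
Record homogeneous_group (R : realType) (n : nat) := HomogeneousGroup {
  hmul : 'rV[R]_n -> 'rV[R]_n -> 'rV[R]_n ;
  hinv : 'rV[R]_n -> 'rV[R]_n ;
  hmulA : associative hmul ;
  hmul0x : left_id 0 hmul ;
  hmulx0 : right_id 0 hmul ;
  hmulVx : left_inverse 0 hinv hmul ;
  hmulxV : right_inverse 0 hinv hmul ;
  hmul_smooth : smooth (fun z : 'rV[R]_n * 'rV[R]_n => hmul z.1 z.2) ;
  hinv_smooth : smooth hinv ;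
  weight : 'I_n -> R ;
  weight_gt0 : forall i, 0 < weight i ;
  dilation_morph : forall r : R, 0 < r ->
    {morph anisotropic_dilation weight r : x y / hmul x y}
}.

Section homogeneous_group_theory.
Context (R : realType) (n : nat).
Implicit Type G : homogeneous_group R n.

Definition dilation G : R -> 'rV[R]_n -> 'rV[R]_n :=
  anisotropic_dilation (weight G).

Definition homogeneous_dim G : R := \sum_i weight G i.

Record quasi_norm G (N : 'rV[R]_n -> R) : Prop := QuasiNorm {
  qnorm_continuous : continuous N ;
  qnorm_ge0 : forall x, 0 <= N x ;
  qnorm_inv : forall x, N (hinv G x) = N x ;
  qnorm_dilation : forall (r : R) x, 0 < r -> N (dilation G r x) = r * N x ;
  qnorm_eq0 : forall x, N x = 0 <-> x = 0
}.

End homogeneous_group_theory.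

Notation borel T := (g_sigma_algebraType (@open T)).

(* Regularity need not be required: it is automatic for Borel measures on R^n
   that are finite on compact sets. *)
Record haar_measure (R : realType) (n : nat) (G : homogeneous_group R n)
    (mu : {measure set (borel 'rV[R]_n) -> \bar R}) : Prop := HaarMeasure {
  haar_compact : forall K : set 'rV[R]_n, compact K -> (mu K < +oo)%E ;
  haar_neq0 : mu setT != 0%E ;
  haar_left_invariant : forall (x : 'rV[R]_n) (A : set (borel 'rV[R]_n)),
    measurable A -> mu (hmul G x @` A) = mu A
}.

Definition qball (R : realType) (n : nat) (N : 'rV[R]_n -> R) (r : R) :
    set (borel 'rV[R]_n) := [set y | N y < r].

Definition H2B (R : realType) (n : nat)
    (mu : {measure set (borel 'rV[R]_n) -> \bar R}) (N : 'rV[R]_n -> R)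
    (g1 g2 : 'rV[R]_n -> R) (x : 'rV[R]_n) : \bar R :=
  ((\int[mu]_(y in qball N (N x)) (g1 y)%:E) *
   (\int[mu]_(y in qball N (N x)) (g2 y)%:E))%E.

Definition cabs (R : realType) (z : R[i]) : R := ComplexField.Normc.normc z.

Definition measurable_cfun (R : realType) (n : nat) (f : 'rV[R]_n -> R[i]) :
    Prop :=
  measurable_fun [set: borel 'rV[R]_n]
    (f : borel 'rV[R]_n -> borel (R[i] : numFieldType)).

(* Main.v *)
Require Import Defs.
From HB Require Import structures.
From mathcomp Require Import all_boot all_order all_algebra.
From mathcomp Require Import complex.
From mathcomp Require Import all_classical all_reals all_analysis.
From mathcomp Require Import measurable_realfun.
From mathcomp Require Import ring lra.

Set Implicit Arguments.
Unset Strict Implicit.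
Unset Printing Implicit Defensive.

Import Order.TTheory GRing.Theory Num.Theory.
Import numFieldNormedType.Exports.

Local Open Scope classical_set_scope.
Local Open Scope ring_scope.

(** The inequality is governed by the two numbers
    s_i = (beta_i (1 - p_i') + Q) / p_i' = Q - (beta_i + Q) / p_i
    and by t = (alpha + Q) / q: it holds if and only if s_1 > 0, s_2 > 0 and
    t + s_1 + s_2 = 0.  The remaining conditions then follow: t < 0, and the
    condition that involves r2 is equivalent to t + s_2 < 0.

    The only information needed about the group is that the Haar measure of
    the quasi-ball of radius r lies between two multiples of r^Q.  The
    uniqueness of Haar measure and the polar decomposition are avoided by a
    counting argument.  A C^1 group law for which the dilations are
    automorphisms is triangular: up to x_i + y_i, the i-th coordinate of x y
    only depends on the coordinates of smaller weight (hmul_triangular).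
    Hence the left translates of the box [-1, 1)^n by the points with even
    integer coordinates tile R^n (hmul_even_row_inj, hmul_even_row_surj), and
    so do the dilates of these tiles.  As the number of points with even
    integer coordinates in the box dilated by r >= 1 is comparable to r^Q, the
    measures of the boxes dilated by s and by s r differ by a factor
    comparable to r^Q, uniformly in s (box_growth_lower, box_growth_upper).
    Quasi-balls are squeezed between such boxes (ball_growth).

    What remains is analysis on a measure space with a gauge N such that the
    measure of the set N < r is comparable to r^Q.  Cutting into dyadic annuli
    bounds the integral of N^gamma over N < r when gamma > - Q, and over
    N >= r when gamma < - Q, by a multiple of r^(gamma + Q).

    Sufficiency.  Let F_i(r) be the integral of |f_i| over N < r, and X_i the
    weighted norm of f_i.  Hoelder's inequality gives F_i(r) <= c r^(s_i) X_i
    (ball_integral_le), and a Schur test with Tonelli's theorem gives the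
    Hardy inequality for the weight N^(- Q - s_1 p_1) (hardy_inequality).
    Bounding F_2^q and F_1^(q - p_1) by the first estimate leaves F_1^(p_1)
    with exactly that weight, because t + s_1 + s_2 = 0.

    Necessity.  The inequality is tested on powers of N restricted to annuli.
    Indicators of the annuli [r, lambda r) for all r > 0 force
    t + s_1 + s_2 = 0.  The integral of N^(- Q) diverges logarithmically at
    the identity; with f_i = N^(s_i - Q) on e <= N < 1, as e tends to 0, this
    forces s_i > 0. *)

(** * Dilations and continuity along lines *)

Section dilations.
Context (R : realType) (n : nat) (nu : 'I_n -> R).
Hypothesis nu_gt0 : forall i, 0 < nu i.
Local Notation D := (anisotropic_dilation nu).

(** A single dilation parameter makes all the powers r^(nu_i) large; its inverse
    makes all of them small. *)
Lemma exists_weight_powR_ge (M : R) :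
  exists2 K : R, 1 <= K & forall i, M <= K `^ nu i.
Proof.
pose m := Num.max 1 M.
have m1 : 1 <= m by rewrite le_max lexx.
pose g i : R := m `^ (nu i)^-1.
have g0 i : 0 <= g i by exact: powR_ge0.
exists (1 + \sum_i g i); first by rewrite lerDl sumr_ge0.
move=> i; apply: (@le_trans _ _ m); first by rewrite le_max lexx orbT.
have -> : m = g i `^ nu i.
  by rewrite /g -powRrM mulVf ?gt_eqF// powRr1// (le_trans _ m1).
apply: ge0_ler_powR; rewrite ?nnegrE ?addr_ge0 ?sumr_ge0//.
  exact: ltW.
rewrite (bigD1 i)//= addrCA lerDl addr_ge0// sumr_ge0//.
Qed.

Lemma dilationM r s x : 0 <= r -> 0 <= s -> D r (D s x) = D (r * s) x.
Proof. by move=> r0 s0; apply/rowP => i; rewrite !mxE mulrA powRM. Qed.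

Lemma dilation1 x : D 1 x = x.
Proof. by apply/rowP => i; rewrite !mxE powR1 mul1r. Qed.

Lemma dilationK r : 0 < r -> cancel (D r) (D r^-1).
Proof.
move=> r0 x; rewrite dilationM ?invr_ge0 ?(ltW r0)// mulVf ?gt_eqF//.
exact: dilation1.
Qed.

Lemma dilationVK r : 0 < r -> cancel (D r^-1) (D r).
Proof.
move=> r0 x; rewrite dilationM ?invr_ge0 ?(ltW r0)// mulfV ?gt_eqF//.
exact: dilation1.
Qed.

Lemma dilation0 r : D r 0 = 0.
Proof. by apply/rowP => i; rewrite !mxE mulr0. Qed.

Lemma dilationD r x y : D r (x + y) = D r x + D r y.
Proof. by apply/rowP => i; rewrite !mxE mulrDr. Qed.

Lemma dilationZ r a x : D r (a *: x) = a *: D r x.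
Proof. by apply/rowP => i; rewrite !mxE mulrCA. Qed.

Lemma ler_norm_coord (x : 'rV[R]_n) i : `|x ord0 i| <= `|x|.
Proof.
rewrite [leRHS]/Num.Def.normr/= mx_normrE.
exact: (le_bigmax _ (fun x0 => `|x x0.1 x0.2|) (ord0, i)).
Qed.

Lemma norm_rV_le (x : 'rV[R]_n) (e : R) :
  0 <= e -> (forall i, `|x ord0 i| <= e) -> `|x| <= e.
Proof.
move=> e0 xe; rewrite /Num.Def.normr/= mx_normrE;
  apply: bigmax_le => // -[i j] _ /=.
by rewrite ord1.
Qed.

Lemma norm_dilation_le r x (e : R) : (forall i, r `^ nu i <= e) -> 0 <= e ->
  `|D r x| <= e * `|x|.
Proof.
move=> re e0; apply: norm_rV_le; first by rewrite mulr_ge0.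
move=> i; rewrite mxE normrM ger0_norm ?powR_ge0//.
by rewrite ler_pM// ?powR_ge0// ler_norm_coord.
Qed.

End dilations.

Section line.
Context (R : realType) (V W : normedModType R).

(** Directional differentiability is differentiability along a line. *)
Lemma is_derive_line (f : V -> W) (x v : V) (s : R) :
  derivable f (x + s *: v) v ->
  is_derive s 1 (fun t : R => f (x + t *: v)) ('D_v f (x + s *: v)).
Proof.
move=> df.
have E : (fun h : R => h^-1 *: (f (x + (h *: (1:R) + s) *: v) - f (x + s *: v)))
       = (fun h : R => h^-1 *: (f (h *: v + (x + s *: v)) - f (x + s *: v))).
  apply/funext => h; congr (_ *: (f _ - _)).
  by rewrite [h *: 1]mulr1 scalerDl addrCA.
apply: DeriveDef.
- by rewrite /derivable /= E.
- by rewrite /derive /= E.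
Qed.

End line.

(** * Triangular form of the group law *)

Section triangular.
Context (R : realType) (n : nat) (G : homogeneous_group R n).
Local Notation V := ('rV[R]_n * 'rV[R]_n)%type.
Local Notation F := (fun z : V => hmul G z.1 z.2).
Local Notation D := (dilation G).
Local Notation nu := (weight G).
(* The dilations of pairs. *)
Let delta r (z : V) : V := (D r z.1, D r z.2).

(** The increment of the i-th coordinate of the product in a direction v of
    weight nu j >= nu i is linear.  By homogeneity the increment at z is
    r^(- nu i) times an increment at the point z dilated by r; by the mean
    value theorem the latter is r^(nu j) t times a derivative at a point that
    tends to 0 with r. *)
Lemma hmul_line_ge0 (v : V) (i j : 'I_n) (c : R) :
    nu i <= nu j -> (forall r, 0 < r -> delta r v = r `^ nu j *: v) ->
    (forall t, F (t *: v) ord0 i = t * c) -> (nu i < nu j -> c = 0) ->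
  forall z t, 0 <= t -> F (z + t *: v) ord0 i = F z ord0 i + t * c.
Proof.
move=> nuij Hv F0 c0 z t t0.
have [_ /(_ v) [dF cF]] := hmul_smooth G 1%N.
pose f (z : V) : R := F z ord0 i.
pose g (z : V) : R := ('D_v F z : 'rV[R]_n) ord0 i.
have df (x : V) (s : R) :
    is_derive s 1 (fun t : R => f (x + t *: v)) (g (x + s *: v)).
  have H := is_derive_line (dF (x + s *: v)).
  have [H1 H2] := H.
  apply: DeriveDef; first exact: (derivable_mxP _ _ _).1 H1 ord0 i.
  have := derive_mx H1; rewrite H2 /g => ->.
  by rewrite mxE.
have g0 : g 0 = c.
  have := df 0 0; rewrite scale0r addr0 => /@derive_val <-.
  rewrite (_ : (fun t => _) = (c \*: (@id R))).
    by rewrite deriveZ// derive_id [_ *: 1]mulr1.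
  by apply/funext => s; rewrite /f add0r F0 mulrC.
have gc : {for 0, continuous g}.
  apply: (@continuous_comp _ _ _ ('D_v F : V -> 'rV[R]_n)
    (fun M : 'rV[R]_n => M ord0 i)); [exact: cF|exact: coord_continuous].
suff : forall e, 0 < e -> `|f (z + t *: v) - f z - t * c| <= t * e.
  move=> H; apply/eqP; rewrite -subr_eq0 opprD addrA -normr_eq0 eq_le normr_ge0.
  rewrite andbT; apply/ler_addgt0Pr => e e0; rewrite add0r.
  have t1 : 0 < t + 1 by rewrite ltr_wpDl.
  apply: (le_trans (H (e / (t + 1)) _)); first by rewrite divr_gt0.
  by rewrite mulrCA ler_piMr ?(ltW e0)// ler_pdivrMr// mul1r lerDl.
move=> e e0.
have [d /= d0 Hd] : exists2 d, 0 < d & forall y : V, `|y| < d ->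
  `|g y - c| <= e.
  have /cvgrPdist_le/(_ e e0)/nbhs_ballP[d /= d0 H] := gc.
  exists d => // y yd; rewrite distrC -g0; apply: H.
  by rewrite /= -ball_normE /= sub0r normrN.
(* The dilation parameter r = K^-1 is small enough to bring the segment from z
   to z + t v, once dilated, within distance d of the origin. *)
pose B := `|z| + t * `|v|.
have B0 : 0 <= B by rewrite addr_ge0// mulr_ge0.
pose M := B / d + 1.
have M0 : 1 <= M by rewrite lerDr divr_ge0// ltW.
have [K K1 HK] := exists_weight_powR_ge (weight_gt0 G) M.
have K0 : 0 < K by exact: lt_le_trans K1.
pose r := K^-1.
have r0 : 0 < r by rewrite invr_gt0.
have r1 : r <= 1 by rewrite invf_le1.
have rM k : r `^ nu k <= M^-1.
  rewrite /r -powR_inv1 ?(ltW K0)// -powRrM mulN1r powRN lef_pV2 ?posrE//.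
    exact: powR_gt0.
  exact: lt_le_trans M0.
have Mi : 0 < M^-1 by rewrite invr_gt0 (lt_le_trans _ M0).
have dl s : 0 <= s -> s <= t * r `^ nu j -> `|delta r z + s *: v| < d.
  move=> s0 st.
  apply: (@le_lt_trans _ _ (M^-1 * B)); last first.
    rewrite mulrC ltr_pdivrMr ?(lt_le_trans _ M0)// /M mulrDr mulr1 mulrCA.
    by rewrite mulfV ?gt_eqF// mulr1 ltrDl.
  apply: (le_trans (ler_normD _ _)); rewrite /B mulrDr lerD//.
    rewrite /delta !prod_normE /= ge_max.
    rewrite !(le_trans (norm_dilation_le _ rM (ltW Mi)))//.
      by rewrite ler_pM2l// le_max lexx orbT.
    by rewrite ler_pM2l// le_max lexx.
  rewrite normrZ (ger0_norm s0) mulrA ler_wpM2r//.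
  by rewrite (le_trans st)// mulrC ler_wpM2r.
have tr0 : 0 <= t * r `^ nu j by rewrite mulr_ge0// powR_ge0.
have [s] : exists2 s, s \in `[0, (t * r `^ nu j)]%R &
    f (delta r z + (t * r `^ nu j) *: v) - f (delta r z + 0 *: v) =
      g (delta r z + s *: v) * (t * r `^ nu j - 0).
  apply: (MVT_segment (f := fun s => f (delta r z + s *: v))) => //.
  apply: continuous_subspaceT => s.
  have := df (delta r z) s => -[H _].
  apply: differentiable_continuous; exact/derivable1_diffP.
rewrite in_itv /= => /andP[s0 st]; rewrite subr0 scale0r addr0.
have dz : delta r (z + t *: v) = delta r z + (t * r `^ nu j) *: v.
  by rewrite -scalerA -Hv// /delta /= /dilation !dilationD !dilationZ.
have Fd (y : V) : f (delta r y) = r `^ nu i * f y.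
  by rewrite /f /delta /= -dilation_morph// mxE.
rewrite -dz !Fd -mulrBr => E.
have ri : 0 < r `^ nu i by exact: powR_gt0.
have {}E : f (z + t *: v) - f z = t *
  (r `^ (nu j - nu i) * g (delta r z + s *: v)).
  apply: (mulfI (lt0r_neq0 ri)); rewrite E powRD ?(gt_eqF r0) ?implybT// powRN.
  by field; rewrite gt_eqF.
have gs : `|g (delta r z + s *: v) - c| <= e by apply: Hd; exact: dl.
rewrite E -mulrBr normrM ger0_norm// ler_wpM2l//.
move: nuij; rewrite le_eqVlt => /predU1P[->|nuij].
  by rewrite subrr powRr0 mul1r.
rewrite c0// subr0; rewrite c0// subr0 in gs.
rewrite normrM ger0_norm ?powR_ge0// -[leRHS]mul1r ler_pM ?powR_ge0//.
by rewrite -(powRr0 r); apply: ger_powR; rewrite ?r0// subr_ge0 ltW.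
Qed.

Lemma hmul_line (v : V) (i j : 'I_n) (c : R) :
    nu i <= nu j -> (forall r, 0 < r -> delta r v = r `^ nu j *: v) ->
    (forall t, F (t *: v) ord0 i = t * c) -> (nu i < nu j -> c = 0) ->
  forall z t, F (z + t *: v) ord0 i = F z ord0 i + t * c.
Proof.
move=> nuij Hv F0 c0 z t.
have H := hmul_line_ge0 nuij Hv F0 c0.
have [/H//|t0] := leP 0 t.
have := H (z + t *: v) (- t); rewrite oppr_ge0 => /(_ (ltW t0)).
by rewrite scaleNr addrK => ->; rewrite mulNr subrK.
Qed.

Lemma dilation_delta r j : D r (delta_mx 0 j) = r `^ nu j *: delta_mx 0 j.
Proof.
by apply/rowP => k; rewrite !mxE eqxx /=; case: eqP => [->|_]; rewrite ?mulr0.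
Qed.

Lemma hmul_deltal x y t (i j : 'I_n) : nu i <= nu j ->
  hmul G (x + t *: delta_mx 0 j) y ord0 i = hmul G x y ord0 i + t * (i == j)%:R.
Proof.
move=> ij.
have := @hmul_line (delta_mx 0 j, 0) i j (i == j)%:R ij _ _ _ (x, y) t.
rewrite /= scaler0 addr0; apply.
- by move=> r r0; congr (_, _); [exact: dilation_delta|
    rewrite /= scaler0; exact: dilation0].
- by move=> s; rewrite /= scaler0 hmulx0 !mxE eqxx.
- by case: eqP => // ->; rewrite ltxx.
Qed.

Lemma hmul_deltar x y t (i j : 'I_n) : nu i <= nu j ->
  hmul G x (y + t *: delta_mx 0 j) ord0 i = hmul G x y ord0 i + t * (i == j)%:R.
Proof.
move=> ij.
have := @hmul_line (0, delta_mx 0 j) i j (i == j)%:R ij _ _ _ (x, y) t.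
rewrite /= scaler0 addr0; apply.
- by move=> r r0; congr (_, _); [
    rewrite /= scaler0; exact: dilation0|exact: dilation_delta].
- by move=> s; rewrite /= scaler0 hmul0x !mxE eqxx.
- by case: eqP => // ->; rewrite ltxx.
Qed.

Lemma row_sub_sum_delta (x x' : 'rV[R]_n) (i : 'I_n) :
    (forall k, nu k < nu i -> x ord0 k = x' ord0 k) ->
  x' = x + \sum_(j <- [seq j <- enum 'I_n | nu i <= nu j])
             (x' ord0 j - x ord0 j) *: delta_mx 0 j.
Proof.
move=> xx'; apply/eqP; rewrite addrC -subr_eq; apply/eqP.
rewrite [LHS]row_sum_delta big_filter [LHS](bigID (fun j => nu i <= nu j)) /=.
rewrite [X in _ + X]big1 ?addr0; last first.
  by move=> k; rewrite -ltNge !mxE => /xx' ->; rewrite subrr scale0r.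
by rewrite big_enum_cond; apply: eq_bigr => j _; rewrite !mxE.
Qed.

Lemma hmul_suml (s : seq 'I_n) (t : 'I_n -> R) (x y : 'rV[R]_n) (i : 'I_n) :
  all (fun j => nu i <= nu j) s ->
  hmul G (x + \sum_(j <- s) t j *: delta_mx 0 j) y ord0 i =
  hmul G x y ord0 i + \sum_(j <- s) t j * (i == j)%:R.
Proof.
elim: s x => [|j s IH] x /=; first by rewrite !big_nil !addr0.
by move=> /andP[ij /IH{}IH]; rewrite !big_cons addrA IH hmul_deltal// addrA.
Qed.

Lemma hmul_sumr (s : seq 'I_n) (t : 'I_n -> R) (x y : 'rV[R]_n) (i : 'I_n) :
  all (fun j => nu i <= nu j) s ->
  hmul G x (y + \sum_(j <- s) t j *: delta_mx 0 j) ord0 i =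
  hmul G x y ord0 i + \sum_(j <- s) t j * (i == j)%:R.
Proof.
elim: s y => [|j s IH] y /=; first by rewrite !big_nil !addr0.
by move=> /andP[ij /IH{}IH]; rewrite !big_cons addrA IH hmul_deltar// addrA.
Qed.

(** The group law is triangular: the i-th coordinate of x y is x_i + y_i plus
    a function of the coordinates of x and y of weight smaller than nu i. *)
Lemma hmul_triangular (x x' y y' : 'rV[R]_n) i :
    (forall k, nu k < nu i -> x ord0 k = x' ord0 k) ->
    (forall k, nu k < nu i -> y ord0 k = y' ord0 k) ->
  hmul G x' y' ord0 i - x' ord0 i - y' ord0 i =
  hmul G x y ord0 i - x ord0 i - y ord0 i.
Proof.
move=> xx' yy'.
have sum_i (z z' : 'rV[R]_n) :
  (\sum_(j <- [seq j <- enum 'I_n | nu i <= nu j])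
     (z' ord0 j - z ord0 j) * (i == j)%:R) = z' ord0 i - z ord0 i.
  rewrite big_filter big_enum_cond/= (bigD1 i)//= eqxx mulr1 big1 ?addr0//.
  by move=> j /andP[_ /negbTE]; rewrite eq_sym => ->; rewrite mulr0.
have Hl y0 : hmul G x' y0 ord0 i = hmul G x y0 ord0 i + (x' ord0 i - x ord0 i).
  by rewrite {1}(row_sub_sum_delta xx') hmul_suml ?filter_all// sum_i.
have Hr x0 : hmul G x0 y' ord0 i = hmul G x0 y ord0 i + (y' ord0 i - y ord0 i).
  by rewrite {1}(row_sub_sum_delta yy') hmul_sumr ?filter_all// sum_i.
by rewrite Hl Hr; ring.
Qed.

End triangular.

(** * Tiling of the group by translates of a box *)

Section tiling.
Context (R : realType) (n : nat) (G : homogeneous_group R n).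
Local Notation D := (dilation G).
Local Notation nu := (weight G).

(** The dilate by s of the half-open box [-1, 1)^n. *)
Definition box (s : R) : set 'rV[R]_n :=
  [set x | forall i, - s `^ nu i <= x ord0 i < s `^ nu i].

(** The points with even integer coordinates, which are the centres of the
    tiling by translates of the box of side length 2. *)
Definition even_row (k : 'I_n -> int) : 'rV[R]_n :=
  \row_i (2 * (k i)%:~R).

Lemma box1E y i : box 1 y -> - 1 <= y ord0 i < 1.
Proof. by move=> /(_ i); rewrite powR1. Qed.

(** Induction on the coordinates along increasing weights. *)
Lemma weight_ind (P : 'I_n -> Prop) :
  (forall i, (forall j, nu j < nu i -> P j) -> P i) -> forall i, P i.
Proof.
move=> IH i; have [m] := ubnP #|[set j | nu j < nu i]%SET|.
elim: m i => // m IHm i im; apply: IH => j ji; apply: IHm.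
rewrite -ltnS (leq_trans _ im)// ltnS; apply: proper_card; apply/properP; split.
  by apply/fintype.subsetP => k; rewrite !inE => /lt_trans; exact.
by exists j; rewrite !inE ?ltxx.
Qed.

Lemma even_itv_uniq (k k' : int) (y y' : R) :
  -1 <= y < 1 -> -1 <= y' < 1 -> 2 * k%:~R + y = 2 * k'%:~R + y' -> k = k'.
Proof.
move=> /andP[y1 y2] /andP[y1' y2'] E.
have lt1 (a b : int) : (a%:~R - b%:~R < 1 :> R) -> a <= b.
  by rewrite ltrBlDr -[X in X + _]/(1%:~R) -rmorphD ltr_int addrC ltzD1.
by apply/eqP; rewrite eq_le !lt1//; lra.
Qed.

(** The translates of the unit box by even points are disjoint: coordinates are
    identified one weight after the other. *)
Lemma hmul_even_row_inj (k k' : 'I_n -> int) y y' :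
  box 1 y -> box 1 y' ->
  hmul G (even_row k) y = hmul G (even_row k') y' -> k =1 k'.
Proof.
move=> y1 y1' E.
suff H i : k i = k' i /\ y ord0 i = y' ord0 i by move=> i; have [] := H i.
elim/weight_ind: i => i IH.
have T : hmul G (even_row k') y' ord0 i - even_row k' ord0 i - y' ord0 i =
    hmul G (even_row k) y ord0 i - even_row k ord0 i - y ord0 i.
  by apply: hmul_triangular => j /IH[kk yy] //; rewrite !mxE kk.
move: T; rewrite E !mxE => T.
have {}T : 2 * (k i)%:~R + y ord0 i = 2 * (k' i)%:~R + y' ord0 i.
  by move: T; move: (hmul _ _ _ _ _) => c; lra.
have kk := even_itv_uniq (box1E i y1) (box1E i y1') T.
by split=> //; move: T; rewrite kk => /addrI.
Qed.

Lemma exists_even_itv (c : R) : exists k : int, -1 <= c - 2 * k%:~R < 1.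
Proof.
exists (Num.floor ((c + 1) / 2)).
by have /andP[] := floor_itv ((c + 1) / 2); rewrite intrD => *; apply/andP;
  split; lra.
Qed.

(** The translates of the unit box by even points cover R^n.  The coordinates
    are solved in the order of increasing weights; by triangularity, adjusting
    the coordinate i does not disturb the ones solved before. *)
Lemma hmul_even_row_surj z :
  exists k : 'I_n -> int, exists2 y, box 1 y & hmul G (even_row k) y = z.
Proof.
suff H m (S : {set 'I_n}) : #|S| = m ->
    (forall i j, i \in S -> j \notin S -> nu i <= nu j) ->
    exists k : 'I_n -> int, exists2 y, box 1 y &
      forall i, i \in S -> hmul G (even_row k) y ord0 i = z ord0 i.
  have [||k [y y1 yz]] := H n [set: 'I_n]%SET.
  - by rewrite cardsT card_ord.
  - by move=> i j _; rewrite inE.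
  - by exists k, y => //; apply/rowP => i; apply: yz; rewrite inE.
elim: m S => [|m IH] S.
  move/eqP; rewrite cards_eq0 => /eqP -> _.
  exists (fun=> 0), 0; last by move=> i; rewrite inE.
  by move=> i; rewrite mxE powR1; apply/andP; split; lra.
move=> Sm Sdown.
have [i0 i0S] : exists i, i \in S by apply/set0Pn; rewrite -cards_eq0 Sm.
(* The last coordinate to be solved is one of largest weight. *)
case: (arg_maxP nu i0S) => i iS0 imax; have iS : i \in S by [].

have [||k [y y1 yz]] := IH (S :\ i)%SET.
- by apply/eqP; move: Sm; rewrite (cardsD1 i) iS add1n => -[->].
- move=> a b; rewrite !inE negb_and negbK => /andP[ai aS] /orP[/eqP->|bS].
    exact: imax.
  exact: Sdown.
pose c := z ord0 i - (hmul G (even_row k) y ord0 i - 2 * (k i)%:~R - y ord0 i).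
have [k0 k0c] := exists_even_itv c.
pose k' j := if j == i then k0 else k j.
pose y' := y + (c - 2 * k0%:~R - y ord0 i) *: delta_mx 0 i.
exists k', y'.
  move=> j; rewrite !mxE eqxx; have [->|_] := eqVneq j i.
    by rewrite mulr1 addrC subrK powR1.
  by rewrite mulr0 addr0; exact: y1.
have -> : even_row k' = even_row k +
  (2 * k0%:~R - 2 * (k i)%:~R) *: delta_mx 0 i.
  apply/rowP => j; rewrite !mxE eqxx /k'; have [->|_] := eqVneq j i.
    by rewrite mulr1 addrC subrK.
  by rewrite mulr0 addr0.
move=> j jS; have ji : nu j <= nu i by exact: imax.
rewrite /y' hmul_deltar// hmul_deltal//.
have [->|jni] := eqVneq j i; last first.
  by rewrite !mulr0 !addr0; apply: yz; rewrite !inE jni.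
by rewrite !mulr1 /c; ring.
Qed.

Lemma dilation_box r s x : 0 < r -> 0 <= s -> box s x -> box (r * s) (D r x).
Proof.
move=> r0 s0 sx i; rewrite mxE powRM ?(ltW r0)// -mulrN.
by rewrite ler_pM2l ?powR_gt0// ltr_pM2l ?powR_gt0.
Qed.

Lemma box_norm_lt s x : (forall i, `|x| < s `^ nu i) -> box s x.
Proof.
move=> H i; have := le_lt_trans (ler_norm_coord x i) (H i).
by rewrite ltr_norml => /andP[/ltW -> ->].
Qed.

Lemma box1_norm x : box 1 x -> `|x| <= 1.
Proof.
move=> H; apply: norm_rV_le => // i; have /andP[] := box1E i H.
by rewrite ler_norml => -> /ltW ->.
Qed.

Lemma compact_unit_ball : compact [set x : 'rV[R]_n | `|x| <= 1].
Proof.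
apply: bounded_closed_compact.
  by exists 1; split => // M M1 x /= x1; rewrite (le_trans x1)// ltW.
apply: (@closed_comp _ _ (fun x : 'rV[R]_n => `|x|) [set r : R | r <= 1]).
  by move=> x _; exact: norm_continuous.
exact: closed_le.
Qed.

Lemma hmul_cont : continuous (fun z : 'rV[R]_n * 'rV[R]_n => hmul G z.1 z.2).
Proof. exact: hmul_smooth G 0%N. Qed.

Lemma hinv_cont : continuous (hinv G).
Proof. exact: hinv_smooth G 0%N. Qed.

Lemma hmul_bounded : exists M : R, forall x y : 'rV[R]_n,
  `|x| <= 1 -> `|y| <= 1 -> `|hmul G x y| <= M /\ `|hmul G x (hinv G y)| <= M.
Proof.
pose B := [set x : 'rV[R]_n | `|x| <= 1].
have cBB := compact_setX compact_unit_ball compact_unit_ball.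
have b1 : bounded_set ((fun z : 'rV[R]_n * 'rV[R]_n => hmul G z.1 z.2) @`
  (B `*` B)).
  apply: compact_bounded; apply: continuous_compact cBB.
  exact/continuous_subspaceT/hmul_cont.
have b2 : bounded_set ((fun z : 'rV[R]_n * 'rV[R]_n => hmul G z.1 (hinv G z.2))
  @` (B `*` B)).
  apply: compact_bounded; apply: continuous_compact cBB.
  apply/continuous_subspaceT => z.
  apply: (@continuous2_cvg _ _ _ _ (nbhs z) _ fst (hinv G \o snd) (hmul G)
    z.1 (hinv G z.2)); [exact: (@hmul_cont (z.1, hinv G z.2))|exact: cvg_fst|].
  by apply: (@continuous_comp _ _ _ snd (hinv G));
    [exact: cvg_snd|exact: hinv_cont].
have [M1 [_ H1]] := b1; have [M2 [_ H2]] := b2.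
exists (`|M1| + `|M2| + 1) => x y x1 y1; split.
- apply: (H1 _ _ (hmul G x y)); last by exists (x, y).
  by rewrite (le_lt_trans (ler_norm _))// -addrA ltrDl ltr_wpDl.
- apply: (H2 _ _ (hmul G x (hinv G y))); last by exists (x, y).
  rewrite (le_lt_trans (ler_norm _))// [X in X + _]addrC -addrA ltrDl.
  by rewrite ltr_wpDl.
Qed.

End tiling.

(** * Haar measure of boxes *)

Section borel.
Context (R : realType).

Lemma open_borel (T : ptopologicalType) (A : set T) :
  open A -> measurable (A : set (borel T)).
Proof. by move=> oA; apply: sub_sigma_algebra. Qed.

Lemma closed_borel (T : ptopologicalType) (A : set T) :
  closed A -> measurable (A : set (borel T)).
Proof.
by move=> cA; rewrite -[A]setCK; apply: measurableC; apply: open_borel;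
  exact: closed_openC.
Qed.

Lemma borel_continuous (T U : ptopologicalType) (f : T -> U) :
  continuous f -> measurable_fun setT (f : borel T -> borel U).
Proof.
move=> cf; apply: (@measurability _ _ (borel T) (borel U) setT f (@open U))
  => //.
move=> _ [A oA <-]; rewrite setTI; apply: open_borel.
by apply: open_comp => // x _; exact: cf.
Qed.

Lemma continuous_measurable_real (T : ptopologicalType) (f : T -> R) :
  continuous f -> measurable_fun setT (f : borel T -> R).
Proof.
move=> cf; apply: (measurability _ (RGenOpens.measurableE R)) => _
  [_ [a [b ->]] <-].
rewrite setTI; apply: open_borel; apply: open_comp; last exact: interval_open.
by move=> x _; exact: cf.
Qed.

End borel.

Section box_measure.
Context (R : realType) (n : nat) (G : homogeneous_group R n).
Context (mu : {measure set (borel 'rV[R]_n) -> \bar R}).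
Hypothesis hmu : haar_measure G mu.
Local Notation D := (dilation G).
Local Notation nu := (weight G).
Local Notation Q := (homogeneous_dim G).

Lemma measurable_box s : measurable (box G s : set (borel 'rV[R]_n)).
Proof.
rewrite (_ : box G s = \bigcap_(i in [set: 'I_n])
  ([set x | - s `^ nu i <= x ord0 i] `&` [set x | x ord0 i < s `^ nu i])).
  apply: fin_bigcap_measurable => // i _; apply: measurableI.
    apply: closed_borel.
    apply: (@closed_comp _ _ (fun x : 'rV[R]_n => x ord0 i)
      [set r : R | - s `^ nu i <= r]).
      by move=> x _; exact: coord_continuous.
    exact: closed_ge.
  apply: open_borel.
  apply: (@open_comp _ _ (fun x : 'rV[R]_n => x ord0 i)
    [set r : R | r < s `^ nu i]).
    by move=> x _; exact: coord_continuous.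
  exact: open_lt.
apply/seteqP; split=> x; first by move=> H i _; have /andP[] := H i.
by move=> H i; have [/= -> ->] := H i I.
Qed.

(** The tiling at scale s: the dilates by s of the tiles even_row k * box 1. *)
Definition tile (s : R) (k : 'I_n -> int) : set (borel 'rV[R]_n) :=
  hmul G (D s (even_row R k)) @` box G s.

Lemma measurable_tile s k : measurable (tile s k).
Proof.
set a := D s (even_row R k).
rewrite (_ : tile s k = (hmul G (hinv G a)) @^-1` box G s).
  rewrite -[X in measurable X]setTI.
  have H : measurable_fun setT
    (hmul G (hinv G a) : borel 'rV[R]_n -> borel 'rV[R]_n).
    apply: borel_continuous => x.
    apply: (@continuous2_cvg _ _ _ _ (nbhs x) _ (cst (hinv G a)) id (hmul G)
      (hinv G a) x); [exact: (@hmul_cont _ _ G (hinv G a, x))|exact: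
        cvg_cst|exact: cvg_id].
  exact: (H measurableT _ (measurable_box s)).
apply/seteqP; split => x /=; first by move=> [y ys <-];
  rewrite hmulA hmulVx hmul0x.
by move=> H; exists (hmul G (hinv G a) x) => //; rewrite hmulA hmulxV hmul0x.
Qed.

Lemma measure_tile s k : mu (tile s k) = mu (box G s).
Proof. by apply: (haar_left_invariant hmu); exact: measurable_box. Qed.

Lemma box_dilationV s y : 0 < s -> box G s y -> box G 1 (D s^-1 y).
Proof.
move=> s0 ys; have := dilation_box (r := s^-1) _ (ltW s0) ys.
by rewrite mulVf ?gt_eqF// invr_gt0; exact.
Qed.

Lemma tile_inj s k k' x : 0 < s -> tile s k x -> tile s k' x -> k =1 k'.
Proof.
move=> s0 [y ys <-] [y' ys' E].
apply: (@hmul_even_row_inj _ _ G k k' (D s^-1 y) (D s^-1 y')).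
- exact: box_dilationV.
- exact: box_dilationV.
apply: (can_inj (dilationK (weight G) s0)).
rewrite !dilation_morph// -/D.
by rewrite /D !dilationVK.
Qed.

Lemma tile_surj s x : 0 < s -> exists k, tile s k x.
Proof.
move=> s0; have [k [y y1 E]] := hmul_even_row_surj G (D s^-1 x).
exists k; exists (D s y).
  by have := dilation_box s0 ler01 y1; rewrite mulr1.
by rewrite -dilation_morph// E /D dilationVK.
Qed.

End box_measure.

Section finite_unions.
Local Open Scope ereal_scope.
Context d (T : measurableType d) (R : realType)
  (mu : {measure set T -> \bar R}).
Context (I : choiceType) (F : I -> set T).
Hypothesis mF : forall i, measurable (F i).

Lemma measure_bigsetU_disjoint (s : seq I) : uniq s ->
  (forall i j x, F i x -> F j x -> i = j) ->
  mu (\big[setU/set0]_(i <- s) F i) = \sum_(i <- s) mu (F i).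
Proof.
move=> us disj; elim: s us => [|i s IH] /=; first by rewrite !big_nil measure0.
move=> /andP[i_s /IH{}IH]; rewrite !big_cons -IH measureU//.
  exact: bigsetU_measurable.
apply/seteqP; split => // x [Fi]; rewrite -bigcup_seq => -[j /= js Fj].
by move: i_s; rewrite (disj _ _ _ Fi Fj) js.
Qed.

Lemma measure_bigsetU_le (s : seq I) :
  mu (\big[setU/set0]_(i <- s) F i) <= \sum_(i <- s) mu (F i).
Proof.
elim: s => [|i s IH] /=; first by rewrite !big_nil measure0.
rewrite !big_cons; apply: le_trans (leeD2l _ IH).
by apply: measureU2 => //; exact: bigsetU_measurable.
Qed.

Lemma sume_const_ge0 (J : finType) (x : \bar R) : 0 <= x ->
  \sum_(j : J) x = #|J|%:R%:E * x.
Proof.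
move=> x0; rewrite big_const; elim: #|J| => [|m IH] /=; first by rewrite mul0e.
by rewrite IH -natr1 EFinD ge0_muleDl// mul1e addeC.
Qed.

End finite_unions.

Section box_growth.
Context (R : realType) (n : nat) (G : homogeneous_group R n).
Context (mu : {measure set (borel 'rV[R]_n) -> \bar R}).
Hypothesis hmu : haar_measure G mu.
Local Notation D := (dilation G).
Local Notation nu := (weight G).
Local Notation Q := (homogeneous_dim G).

Lemma prod_powR_weight (r : R) : 0 < r -> \prod_i r `^ nu i = r `^ Q.
Proof.
move=> r0; rewrite /homogeneous_dim.
elim/big_ind2 : _ => [|x a y b -> ->|//]; first by rewrite powRr0.
by rewrite powRD// (gt_eqF r0) implybT.
Qed.

Lemma card_dffun_ord (c : 'I_n -> nat) :
  #|{dffun forall i : 'I_n, 'I_(c i)}| = (\prod_i c i)%N.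
Proof.
rewrite card_dep_ffun foldrE big_map big_enum /=.
by apply: eq_bigr => i _; rewrite card_ord.
Qed.

Lemma norm_dilationV_le (r : R) (x : 'rV[R]_n) : 1 <= r -> `|D r^-1 x| <= `|x|.
Proof.
move=> r1; rewrite -[leRHS]mul1r; apply: norm_dilation_le => // i.
have r0 : 0 < r by exact: lt_le_trans r1.
rewrite -[leRHS](congr1 (@^~ (nu i)) (powR1 R)); apply: ge0_ler_powR;
  rewrite ?nnegrE ?invr_ge0 ?(ltW r0)//.
  exact/ltW/weight_gt0.
by rewrite invf_le1.
Qed.

(** At least a multiple of r^Q disjoint tiles of scale s, those centred at the
    dilates of the even points with coordinates in [0, r^(nu_i)], lie in the
    box of size s r K. *)
Lemma box_growth_lower : exists K c : R, [/\ 1 <= K, 0 < c &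
  forall s r, 0 < s -> 1 <= r ->
    ((c * r `^ Q)%:E * mu (box G s) <= mu (box G (s * r * K)))%E].
Proof.
have [M HM] := hmul_bounded G.
have [K K1 MK] := exists_weight_powR_ge (weight_gt0 G) (M + 1).
exists K, (\prod_(i < n) 2^-1); split=> //; first by apply: prodr_gt0.
move=> s r s0 r1; have r0 : 0 < r by exact: lt_le_trans r1.
have K0 : 0 < K by exact: lt_le_trans K1.
pose c (i : 'I_n) := (Num.trunc (r `^ nu i / 2)).+1.
(* The tiles are indexed by the points 2 k with 0 <= k_i < c i. *)
pose I := {dffun forall i : 'I_n, 'I_(c i)}.
pose F (f : I) := tile G s (fun i => Posz (f i)).
have mF f : measurable (F f) by exact: measurable_tile.
have disj f g x : F f x -> F g x -> f = g.
  move=> fx gx; apply/ffunP => i; apply/val_inj.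
  by have /= := tile_inj s0 fx gx i => -[].
apply: (@le_trans _ _ (mu (\big[setU/set0]_(f : I) F f))).
  rewrite measure_bigsetU_disjoint ?index_enum_uniq//.
  rewrite (eq_bigr (fun=> mu (box G s))); last by move=> f _;
    exact: measure_tile.
  rewrite sume_const_ge0// card_dffun_ord.
  apply: lee_wpmul2r => //; rewrite lee_fin natr_prod -prod_powR_weight//.
  rewrite -big_split/=; apply: ler_prod => i _.
  rewrite mulr_ge0 ?powR_ge0 ?invr_ge0//= mulrC; apply: ltW.
  by apply: truncnS_gt.
apply: le_measure; rewrite ?inE;
  [exact: bigsetU_measurable|exact: measurable_box|].
rewrite -bigcup_seq => _ [f _ [y ys <-]].
set k := even_row R _.
have sr0 : 0 < s * r by rewrite mulr_gt0.
rewrite -[hmul _ _ _](dilationVK nu sr0); apply: dilation_box (ltW K0) _ => //.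
rewrite /dilation dilation_morph ?invr_gt0//.
apply: box_norm_lt => i; apply: lt_le_trans (MK i).
apply: (@le_lt_trans _ _ M); last by rewrite ltrDl.
apply: (HM _ _ _ _).1.
  rewrite dilationM ?invr_ge0 ?(ltW sr0) ?(ltW s0)// invfM mulrAC mulVf
    ?gt_eqF// mul1r.
  apply: norm_rV_le => // j; rewrite !mxE.
  rewrite -powR_inv1 ?(ltW r0)// -powRrM mulN1r powRN.
  rewrite normrM normfV (ger0_norm (powR_ge0 _ _)) ler_pdivrMl
    ?powR_gt0// mulr1.
  rewrite ger0_norm ?mulr_ge0 ?ler0n// -ler_pdivlMl// mulrC.
  have := ltn_ord (f j); rewrite /c ltnS truncn_ge_nat//.
  by rewrite divr_ge0 ?powR_ge0.
rewrite invfM mulrC -dilationM ?invr_ge0 ?(ltW r0) ?(ltW s0)//.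
apply: le_trans (norm_dilationV_le _ r1) _.
exact: box1_norm (box_dilationV s0 ys).
Qed.

(** At most a multiple of r^Q tiles of scale s meet the box of size s r, since
    their centres lie in a box of comparable size. *)
Lemma box_growth_upper : exists2 C : R, 0 < C &
  forall s r, 0 < s -> 1 <= r ->
    (mu (box G (s * r)) <= (C * r `^ Q)%:E * mu (box G s))%E.
Proof.
have [M0 HM] := hmul_bounded G.
pose M := `|M0| + 1.
have M1 : 1 <= M by rewrite lerDr.
have M00 : 0 < M by exact: lt_le_trans M1.
exists (\prod_(i < n) (M + 1)); first by apply: prodr_gt0 => i _;
  rewrite addr_gt0.
move=> s r s0 r1; have r0 : 0 < r by exact: lt_le_trans r1.
pose c (i : 'I_n) := Num.trunc (M * r `^ nu i / 2).
have c0 i : 0 <= M * r `^ nu i / 2 by rewrite !mulr_ge0 ?powR_ge0 ?(ltW M00)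
  ?invr_ge0.
(* The tiles are indexed by the points 2 k with |k_i| <= c i, where k_i + c i is
   represented by an ordinal. *)
pose I := {dffun forall i : 'I_n, 'I_(2 * c i).+1}.
pose F (f : I) := tile G s (fun i => (f i)%:Z - (c i)%:Z).
have mF f : measurable (F f) by exact: measurable_tile.
apply: (@le_trans _ _ (mu (\big[setU/set0]_(f : I) F f))).
  apply: le_measure; rewrite ?inE;
    [exact: measurable_box|exact: bigsetU_measurable|].
  move=> x xB; have [k kx] := tile_surj G x s0.
  have kc i : (`|k i| <= c i)%N.
    have [y ys E] := kx.
    have sr0 : 0 < s * r by rewrite mulr_gt0.
    pose w := D r^-1 (even_row R k).
    have wE : w = hmul G (D (s * r)^-1 x) (hinv G (D r^-1 (D s^-1 y))).
      rewrite -E /w /dilation dilation_morph ?invr_gt0// invfM mulrC.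
      rewrite -[anisotropic_dilation _ (_ * _)
        (anisotropic_dilation _ s _)]dilationM ?invr_ge0 ?(ltW r0) ?(ltW s0)//.
      rewrite dilationK// -[anisotropic_dilation _ (_ * _) y]dilationM ?invr_ge0
        ?(ltW r0) ?(ltW s0)//.
      by rewrite -hmulA hmulxV hmulx0.
    have : `|w| <= M0.
      rewrite wE; apply: (HM _ _ _ _).2;
        first exact: box1_norm (box_dilationV sr0 xB).
      apply: le_trans (norm_dilationV_le _ r1) _.
      exact: box1_norm (box_dilationV s0 ys).
    move=> /(le_trans (ler_norm_coord w i)) wM.
    rewrite truncn_ge_nat//.
    move: wM; rewrite !mxE -powR_inv1 ?(ltW r0)// -powRrM mulN1r powRN.
    rewrite normrM normfV (ger0_norm (powR_ge0 _ _)) ler_pdivrMl ?powR_gt0//.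
    rewrite normrM [`|2|]ger0_norm// -intr_norm => wM.
    rewrite ler_pdivlMr// mulrC natr_absz (le_trans wM)// mulrC.
    by rewrite ler_wpM2r ?powR_ge0// /M (le_trans (ler_norm _))// lerDl.
  rewrite -bigcup_seq.
  exists ([ffun i => inord `|(k i + c i)%R|%N] : I) => //=;
    first by rewrite mem_index_enum.
  rewrite /F (_ : (fun i => _) = k)//.
  apply/funext => i; rewrite ffunE.
  have /andP[k1 k2] : - (c i)%:Z <= k i <= (c i)%:Z.
    by rewrite -ler_norml -abszE lez_nat.
  have kc0 : 0 <= k i + c i by rewrite -lerBlDr sub0r.
  rewrite inordK; first by rewrite gez0_abs// addrK.
  rewrite ltnS -lez_nat gez0_abs//.
  by rewrite mul2n -addnn PoszD lerD2r.
apply: le_trans (measure_bigsetU_le _ mF _) _.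
rewrite (eq_bigr (fun=> mu (box G s))); last by move=> f _; exact: measure_tile.
rewrite sume_const_ge0// card_dffun_ord.
apply: lee_wpmul2r => //; rewrite lee_fin natr_prod -prod_powR_weight//.
rewrite -big_split/=; apply: ler_prod => i _; rewrite ler0n/=.
have r1i : 1 <= r `^ nu i.
  by rewrite -(powRr0 r); apply: ler_powR => //; exact/ltW/weight_gt0.
rewrite mulrDl mul1r -natr1 lerD// natrM.
by rewrite -ler_pdivlMl// [leRHS]mulrC -truncn_ge_nat.
Qed.

End box_growth.

(** * Volume growth of quasi-balls *)

Section ball_growth.
Context (R : realType) (n : nat) (G : homogeneous_group R n).
Context (mu : {measure set (borel 'rV[R]_n) -> \bar R}).
Hypothesis hmu : haar_measure G mu.
Local Notation D := (dilation G).
Local Notation nu := (weight G).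
Local Notation Q := (homogeneous_dim G).

Lemma homogeneous_dim_ge0 : 0 <= Q.
Proof. by apply: sumr_ge0 => i _; exact/ltW/weight_gt0. Qed.

Lemma homogeneous_dim_gt0 : (0 < n)%N -> 0 < Q.
Proof.
move=> n0; rewrite /homogeneous_dim (bigD1 (Ordinal n0))//=.
by rewrite ltr_pwDl ?weight_gt0// sumr_ge0// => i _; exact/ltW/weight_gt0.
Qed.

Lemma box_mono s t : 0 <= s -> s <= t -> box G s `<=` box G t.
Proof.
move=> s0 st x xs i; have /andP[x1 x2] := xs i.
have H : s `^ nu i <= t `^ nu i.
  have t0 := le_trans s0 st.
  by apply: ge0_ler_powR; rewrite ?nnegrE//; exact/ltW/weight_gt0.
by rewrite (lt_le_trans x2)// andbT (le_trans _ x1)// lerN2.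
Qed.

Lemma mu_box_le s t : 0 <= s -> s <= t -> (mu (box G s) <= mu (box G t))%E.
Proof.
move=> s0 st; apply: le_measure; rewrite ?inE; do ?exact: measurable_box.
exact: box_mono.
Qed.

Lemma mu_box1_lty : (mu (box G 1) < +oo)%E.
Proof.
have cB := compact_unit_ball (R := R) (n := n).
apply: le_lt_trans (haar_compact hmu cB).
apply: le_measure; rewrite ?inE; first exact: measurable_box.
  by apply: closed_borel; apply: compact_closed => //; exact: norm_hausdorff.
by move=> x; exact: box1_norm.
Qed.

(** If the unit box were null, so would be all the boxes, and then the whole
    space. *)
Lemma mu_box1_gt0 : (0 < mu (box G 1))%E.
Proof.
rewrite lt0e measure_ge0 andbT; apply/negP => /eqP m0.
have [C C0 HC] := box_growth_upper hmu.
have mk (k : nat) : mu (box G k.+1%:R) = 0%E.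
  have := HC 1 k.+1%:R ltr01; rewrite ler1n mul1r m0 mule0 => /(_ isT) H.
  by apply/eqP; rewrite eq_le H measure_ge0.
have : mu.-negligible (\bigcup_k (box G k.+1%:R : set (borel 'rV[R]_n))).
  apply: negligible_bigcup => k; exists (box G k.+1%:R); split => //.
  exact: measurable_box.
have -> : \bigcup_k (box G k.+1%:R : set (borel 'rV[R]_n)) = setT.
  apply/seteqP; split => // x _.
  have [K K1 HK] := exists_weight_powR_ge (weight_gt0 G) (`|x| + 1).
  have K0 : 0 <= K by exact: le_trans K1.
  exists (Num.trunc K) => //=; apply: (@box_mono K) => //.
    exact/ltW/truncnS_gt.
  by apply: box_norm_lt => i; apply: lt_le_trans (HK i); rewrite ltrDl.
move=> /(measure_negligible measurableT) mT.
by have := haar_neq0 hmu; rewrite mT eqxx.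
Qed.

Lemma box_growth : exists a b : R, [/\ 0 < a, 0 < b &
  forall r, 0 < r ->
    ((a * r `^ Q)%:E <= mu (box G r) <= (b * r `^ Q)%:E)%E].
Proof.
have [K [c [K1 c0 low]]] := box_growth_lower hmu.
have [C C0 up] := box_growth_upper hmu.
have K0 : 0 < K by exact: lt_le_trans K1.
pose m := fine (mu (box G 1)).
have mE : mu (box G 1) = m%:E.
  by rewrite fineK// ge0_fin_numE ?measure_ge0// mu_box1_lty.
have m0 : 0 < m by rewrite -lte_fin -mE mu_box1_gt0.
have Kq0 : 0 < K `^ Q by exact: powR_gt0.
have inv r : 0 < r -> r^-1 `^ Q = (r `^ Q)^-1.
  by move=> r0; rewrite -[r^-1]powR_inv1 ?(ltW r0)// -powRrM mulN1r powRN.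
exists (Num.min (m / C) (Num.min (c * m / K `^ Q) (m / K `^ Q))).
exists (Num.max (C * m) (C * K `^ Q * m / c)).
have mC : 0 < m / C by rewrite divr_gt0.
have p2 : 0 < c * m / K `^ Q by rewrite divr_gt0// mulr_gt0.
have p3 : 0 < m / K `^ Q by rewrite divr_gt0.
split.
- by rewrite !lt_min mC p2 p3.
- by rewrite lt_max mulr_gt0.
move=> r r0; have rQ0 : 0 < r `^ Q by exact: powR_gt0.
have [r1|r1] := leP 1 r.
  apply/andP; split; last first.
    have := up 1 r ltr01 r1; rewrite mul1r mE -EFinM => H.
    apply: (le_trans H); rewrite lee_fin mulrAC.
    by rewrite ler_wpM2r ?(ltW rQ0)// le_max lexx.
  have [Kr|rK] := leP K r.
    have /= := low 1 (r / K) ltr01;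
      rewrite ler_pdivlMr// [1 * K]mul1r => /(_ Kr).
    rewrite mul1r divfK ?gt_eqF// mE -EFinM; apply: le_trans.
    rewrite lee_fin powRM ?invr_ge0 ?(ltW r0) ?(ltW K0)// inv//.
    have -> : c * (r `^ Q / K `^ Q) * m = c * m / K `^ Q * r `^ Q by ring.
    by rewrite ler_wpM2r ?(ltW rQ0)// !ge_min lexx orbT.
  apply: (@le_trans _ _ (mu (box G 1))); last exact: mu_box_le.
  rewrite mE lee_fin; apply: (@le_trans _ _ (m / K `^ Q * K `^ Q)); last first.
    by rewrite divfK// gt_eqF.
  rewrite ler_pM ?powR_ge0//; first by rewrite !le_min !ltW.
  - by rewrite !ge_min lexx !orbT.
  - apply: ge0_ler_powR; rewrite ?nnegrE ?(ltW r0) ?(ltW K0) ?(ltW rK)//.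
    exact: homogeneous_dim_ge0.
have ri1 : 1 <= r^-1 by rewrite invf_ge1// ltW.
have mr : mu (box G r) \is a fin_num.
  rewrite ge0_fin_numE ?measure_ge0//; apply: le_lt_trans mu_box1_lty.
  by apply: mu_box_le; rewrite ltW.
apply/andP; split.
  have := up r r^-1 r0 ri1; rewrite mulfV ?gt_eqF// mE inv//.
  rewrite -(fineK mr) -EFinM !lee_fin => H.
  apply: (@le_trans _ _ (m / C * r `^ Q)).
    by rewrite ler_wpM2r ?(ltW rQ0)// ge_min lexx.
  rewrite mulrAC ler_pdivrMr// -ler_pdivlMr//.
  by apply: (le_trans H); rewrite mulrC mulrA mulrAC.
have := low r r^-1 r0 ri1; rewrite mulfV ?gt_eqF// mul1r inv// => H.
have := up 1 K ltr01 K1; rewrite mul1r mE => /(le_trans H).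
rewrite -(fineK mr) -!EFinM !lee_fin => {}H.
apply: (@le_trans _ _ (C * K `^ Q * m / c * r `^ Q)); last first.
  by rewrite ler_wpM2r ?(ltW rQ0)// le_max lexx orbT.
have -> : C * K `^ Q * m / c * r `^ Q = (C * K `^ Q * m) / (c / r `^ Q).
  by field; rewrite !gt_eqF.
by rewrite ler_pdivlMr ?divr_gt0// mulrC.
Qed.

Context (N : 'rV[R]_n -> R).
Hypothesis hN : quasi_norm G N.

Lemma compact_unit_sphere : compact [set x : 'rV[R]_n | `|x| = 1].
Proof.
apply: (@subclosed_compact _ _ [set x : 'rV[R]_n | `|x| <= 1]).
- apply: (@closed_comp _ _ (fun x : 'rV[R]_n => `|x|) [set r : R | r = 1]).
    by move=> x _; exact: norm_continuous.
  exact: closed_eq.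
- exact: compact_unit_ball.
- by move=> x /= ->.
Qed.

(** The quasi-norm is bounded below on the unit sphere of the sup norm, by
    compactness. *)
Lemma qnorm_sphere_ge : exists2 e : R, 0 < e &
  forall x : 'rV[R]_n, `|x| = 1 -> e <= N x.
Proof.
have [[x0 x01]|no] := pselect ([set x : 'rV[R]_n | `|x| = 1] !=set0);
  last first.
  by exists 1 => // x x1; exfalso; apply: no; exists x.
have cN : {within [set x : 'rV[R]_n | `|x| = 1], continuous N}.
  exact/continuous_subspaceT/(qnorm_continuous hN).
have [|c c1 cmin] := @EVT_min_rV _ _ N _ _ compact_unit_sphere cN.
  by exists x0.
exists (N c); last by move=> x x1; apply: cmin; rewrite inE.
rewrite lt_neqAle (qnorm_ge0 hN) andbT;
  apply/negP => /eqP/esym/(qnorm_eq0 hN) c0.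
by move: c1; rewrite c0 inE /= normr0 => /eqP; rewrite eq_sym oner_eq0.
Qed.

(** Every nonzero point can be dilated to the unit sphere of the sup norm; the
    parameter is the largest |x_i|^(1 / nu_i). *)
Lemma exists_dilation_sphere (x : 'rV[R]_n) : x != 0 ->
  exists2 t, 0 < t & `|D t^-1 x| = 1.
Proof.
move=> /rV0Pn[i0 xi0].
pose g i := `|x ord0 i| `^ (nu i)^-1.
have [i _ imax] := @arg_maxP _ _ _ i0 xpredT g isT.
have gi0 : 0 < g i.
  by apply: lt_le_trans (imax i0 isT); rewrite powR_gt0// normr_gt0.
have gp j : g j `^ nu j = `|x ord0 j|.
  by rewrite -powRrM mulVf ?powRr1// gt_eqF// weight_gt0.
exists (g i) => //.
have Dj j : `|D (g i)^-1 x ord0 j| = `|x ord0 j| / g i `^ nu j.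
  rewrite mxE normrM ger0_norm ?powR_ge0// mulrC -[(g i)^-1]powR_inv1
    ?(ltW gi0)//.
  by rewrite -powRrM mulN1r powRN.
apply/eqP; rewrite eq_le; apply/andP; split.
  apply: norm_rV_le => // j; rewrite Dj ler_pdivrMr; last exact: powR_gt0.
  rewrite [1 * _]mul1r -gp.
  apply: ge0_ler_powR; rewrite ?nnegrE ?powR_ge0//; first exact/ltW/weight_gt0.
  exact: imax.
apply: le_trans (ler_norm_coord _ i); rewrite Dj gp mulfV// -gp gt_eqF//.
exact: powR_gt0.
Qed.

(** Boxes and quasi-balls are comparable. *)
Lemma qnorm_box : exists a b : R, [/\ 0 < a, 0 < b &
  forall r, 0 < r -> box G (a * r) `<=` [set x | N x < r] /\
                     [set x | N x < r] `<=` box G (b * r)].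
Proof.
have [e e0 He] := qnorm_sphere_ge.
have [M HM] : exists M : R, forall x : 'rV[R]_n, `|x| <= 1 -> N x <= M.
  have : bounded_set (N @` [set x : 'rV[R]_n | `|x| <= 1]).
    apply: compact_bounded; apply: continuous_compact;
      last exact: compact_unit_ball.
    exact/continuous_subspaceT/(qnorm_continuous hN).
  move=> [M [_ H]]; exists (`|M| + 1) => x x1.
  apply: le_trans (ler_norm _) _; apply: (H (`|M| + 1)); last by exists x.
  by rewrite (le_lt_trans (ler_norm _))// ltrDl.
have M1 : 0 < `|M| + 1 by rewrite ltr_wpDl.
exists (`|M| + 1)^-1, e^-1; split; rewrite ?invr_gt0// => r r0; split => x.
  set s := _ * r => xs; have s0 : 0 < s by rewrite mulr_gt0// invr_gt0.
  have := box1_norm (box_dilationV s0 xs) => /HM.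
  rewrite (qnorm_dilation hN) ?invr_gt0// ler_pdivrMl// => /le_lt_trans; apply.
  rewrite /s mulrC mulrA -ltr_pdivlMr// mulfV ?gt_eqF//.
  by rewrite ltr_pdivrMr// mul1r (le_lt_trans (ler_norm _))// ltrDl.
move=> /= xr i; have br : 0 < e^-1 * r by rewrite mulr_gt0// invr_gt0.
have [->|x0] := eqVneq x 0.
  by rewrite mxE oppr_le0 powR_ge0 powR_gt0.
have [t t0 xt] := exists_dilation_sphere x0.
have tr : t < e^-1 * r.
  rewrite -ltr_pdivrMl ?invr_gt0// invrK.
  apply: le_lt_trans xr; rewrite -(dilationVK nu t0 x) (qnorm_dilation hN)//.
  by rewrite mulrC ler_pM2l// He.
have : `|x ord0 i| < (e^-1 * r) `^ nu i.
  apply: (@le_lt_trans _ _ (t `^ nu i)).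
    rewrite -(dilationVK nu t0 x) mxE normrM ger0_norm ?powR_ge0//.
    by rewrite ler_piMr ?powR_ge0// -xt; exact: ler_norm_coord.
  by apply: gt0_ltr_powR; rewrite ?weight_gt0// nnegrE ltW.
by rewrite ltr_norml => /andP[/ltW -> ->].
Qed.

Lemma measurable_qnorm : measurable_fun setT (N : borel 'rV[R]_n -> R).
Proof. exact: continuous_measurable_real (qnorm_continuous hN). Qed.

(** The Haar measure of a quasi-ball of radius r is comparable to r^Q. *)
Lemma ball_growth : exists a b : R, [/\ 0 < a, 0 < b &
  forall r, 0 < r ->
    ((a * r `^ Q)%:E <= mu (qball N r) <= (b * r `^ Q)%:E)%E].
Proof.
have [a [b [a0 b0 H]]] := box_growth.
have [s [t [s0 t0 Hst]]] := qnorm_box.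
have mB r : measurable (qball N r).
  rewrite -[X in measurable X]setTI.
  exact: (measurable_qnorm measurableT (measurable_itv `]-oo, r[%R)).
exists (a * s `^ Q), (b * t `^ Q); split; rewrite ?mulr_gt0 ?powR_gt0// => r r0.
have [sr rt] := Hst r r0.
rewrite -!mulrA -!powRM ?(ltW s0) ?(ltW t0) ?(ltW r0)//; apply/andP; split.
  have /andP[H1 _] := H (s * r) (mulr_gt0 s0 r0).
  apply: (le_trans H1); apply: le_measure; rewrite ?inE //;
    exact: measurable_box.
have /andP[_ H1] := H (t * r) (mulr_gt0 t0 r0).
apply: le_trans H1; apply: le_measure; rewrite ?inE //; exact: measurable_box.
Qed.

End ball_growth.

(** * Integrals of powers of a gauge with polynomial volume growth *)

Lemma ge0_integral_subset_bigcup_le d (T : measurableType d) (R : realType)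
    (mu : {measure set T -> \bar R}) (F : (set T)^nat) (D : set T)
    (f : T -> \bar R) :
    measurable D -> (forall k, measurable (F k)) -> D `<=` \bigcup_k F k ->
    measurable_fun [set: T] f -> (forall x, 0 <= f x)%E ->
  (\int[mu]_(x in D) f x <= \sum_(k <oo) \int[mu]_(x in F k) f x)%E.
Proof.
move=> mD mF DF mf f0.
have mU : measurable (\bigcup_k F k) by exact: bigcupT_measurable.
apply: (@le_trans _ _ (\int[mu]_(x in \bigcup_k F k) f x)%E).
  by apply: ge0_subset_integral => //; exact: measurable_funTS.
have mS k : measurable (seqDU F k).
  by apply: measurableD => //; exact: bigsetU_measurable.
rewrite seqDU_bigcup_eq ge0_integral_bigcup//; last exact: measurable_funTS.
apply: lee_nneseries => k _; first by move=> _; apply: integral_ge0.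
by apply: ge0_subset_integral => //; [exact: measurable_funTS|exact: subDsetl].
Qed.

(** Powers vary by a bounded factor on a dyadic interval, whatever the sign of
    the exponent. *)
Lemma powR_comparable (R : realType) (gam s x : R) : 0 < s -> s <= x ->
  x <= 2 * s ->
  2 `^ (- `|gam|) * s `^ gam <= x `^ gam <= 2 `^ `|gam| * s `^ gam.
Proof.
move=> s0 sx xs; have x0 : 0 < x by exact: lt_le_trans sx.
have [u uE] : exists u, x = u * s by exists (x / s); rewrite divfK// gt_eqF.
have u0 : 0 < u by move: x0; rewrite uE pmulr_lgt0.
have u1 : 1 <= u by rewrite -(ler_pM2r s0) mul1r -uE.
have u2 : u <= 2 by rewrite -(ler_pM2r s0) -uE.
rewrite uE powRM ?(ltW u0) ?(ltW s0)// !ler_pM2r ?powR_gt0//.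
have ub (t : R) : 0 <= t -> u `^ t <= 2 `^ t.
  by move=> t0; apply: ge0_ler_powR; rewrite ?nnegrE ?(ltW u0).
have [g0|g0] := leP 0 gam.
  rewrite (ger0_norm g0) ub// andbT (@le_trans _ _ 1)//.
    by rewrite -[leRHS](powRr0 2); apply: ler_powR; rewrite ?ler1n// oppr_le0.
  by rewrite -[leLHS](powRr0 u); apply: ler_powR.
rewrite (ltr0_norm g0) opprK; apply/andP; split.
  rewrite -[gam]opprK powRN [leRHS]powRN lef_pV2 ?posrE ?powR_gt0//.
  by rewrite ub// oppr_ge0 ltW.
apply: (@le_trans _ _ 1).
  by rewrite -[leRHS](powRr0 u); apply: ler_powR => //; rewrite ltW.
by rewrite -[leLHS](powRr0 2); apply: ler_powR; rewrite ?ler1n// oppr_ge0 ltW.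
Qed.

Section power_growth.
Context d (T : measurableType d) (R : realType)
  (mu : {measure set T -> \bar R}).
Context (N : T -> R) (Q a b : R).
Hypothesis mN : measurable_fun setT N.
Hypothesis N0 : forall x, 0 <= N x.
Hypotheses (Q0 : 0 < Q) (a0 : 0 < a) (b0 : 0 < b).
Hypothesis growth : forall r, 0 < r ->
  ((a * r `^ Q)%:E <= mu [set x | N x < r]%R <= (b * r `^ Q)%:E)%E.

(** The annulus s <= N < t. *)
Definition annulus (s t : R) : set T := [set x | s <= N x < t].

Lemma measurable_annulus s t : measurable (annulus s t).
Proof.
rewrite -[X in measurable X]setTI.
rewrite (_ : annulus s t = N @^-1` `[s, t[%classic); first exact: mN.
by apply/seteqP; split => x /=; rewrite in_itv.
Qed.

Lemma measurable_sublevel r : measurable [set x | N x < r].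
Proof.
by rewrite -[X in measurable X]setTI;
  exact: (mN measurableT (measurable_itv `]-oo, r[%R)).
Qed.

Lemma measurable_powR_N gam : measurable_fun setT (fun x => N x `^ gam).
Proof. exact: (measurableT_comp (measurable_powR gam)). Qed.

Lemma measurable_powR_N_EFin gam : measurable_fun setT
  (fun x => (N x `^ gam)%:E).
Proof. exact/measurable_EFinP/measurable_powR_N. Qed.

Lemma mu_sublevel_lty r : (mu [set x | N x < r]%R < +oo)%E.
Proof.
have r1 : 0 < `|r| + 1 by rewrite ltr_wpDl.
have /andP[_ H] := growth r1.
apply: le_lt_trans (ltry (b * (`|r| + 1) `^ Q)).
apply: le_trans H; apply: le_measure; rewrite ?inE;
  do ?exact: measurable_sublevel.
move=> x /= /lt_le_trans; apply; rewrite (le_trans (ler_norm _))// lerDl//.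
Qed.

Lemma mu_N_eq0 : mu [set x | N x = 0] = 0%E.
Proof.
have mE : measurable [set x | N x = 0].
  by rewrite -[X in measurable X]setTI;
    exact: (mN measurableT (measurable_set1 0)).
apply/eqP; rewrite eq_le measure_ge0 andbT; apply/lee_addgt0Pr => e e0.
rewrite add0e; pose r := (e / b) `^ Q^-1.
have r0 : 0 < r by rewrite powR_gt0// divr_gt0.
have /andP[_] := growth r0.
rewrite /r -powRrM mulVf ?gt_eqF// powRr1 ?divr_ge0 ?(ltW e0)
  ?(ltW b0)// [b * _]mulrC divfK ?gt_eqF//.
apply: le_trans; apply: le_measure; rewrite ?inE//;
  first exact: measurable_sublevel.
by move=> x /= ->.
Qed.

Lemma integral_annulus_le gam s : 0 < s ->
  (\int[mu]_(x in annulus s (2 * s)) (N x `^ gam)%:E <=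
   (2 `^ `|gam| * b * 2 `^ Q * s `^ (gam + Q))%:E)%E.
Proof.
move=> s0; have mA := measurable_annulus s (2 * s).
apply: (@le_trans _ _ (\int[mu]_(x in annulus s (2 * s))
  (cst (2 `^ `|gam| * s `^ gam)%:E) x)%E).
  apply: ge0_le_integral => //.
  - by move=> x _; rewrite lee_fin powR_ge0.
  - exact: measurable_funTS (measurable_powR_N_EFin gam).
  - move=> x /andP[x1 x2]; rewrite lee_fin.
    by have /andP[] := powR_comparable gam s0 x1 (ltW x2).
rewrite integral_cst//.
have s20 : 0 < 2 * s by rewrite mulr_gt0.
have -> : 2 `^ `|gam| * b * 2 `^ Q * s `^ (gam + Q) =
    (2 `^ `|gam| * s `^ gam) * (b * (2 * s) `^ Q).
  by rewrite powRM ?(ltW s0)// powRD ?(gt_eqF s0) ?implybT//; ring.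
rewrite [leRHS]EFinM lee_wpmul2l ?lee_fin ?mulr_ge0 ?powR_ge0//.
have /andP[_ H] := growth s20; apply: le_trans H.
apply: le_measure; rewrite ?inE//; first exact: measurable_sublevel.
by move=> x /= /andP[].
Qed.

(** Integral of N^gam over a region covered by the dyadic annuli of radii
    r th^k, where th = 2 or 1/2 is chosen so that th^(gam + Q) < 1. *)
Lemma integral_geometric_annuli_le gam th (t := th `^ (gam + Q)) : 0 < th ->
  t < 1 ->
  exists2 c : R, 0 < c & forall r (D : set T), 0 < r -> measurable D ->
    D `<=` \bigcup_k annulus (r * th ^+ k) (2 * (r * th ^+ k)) ->
    (\int[mu]_(x in D) (N x `^ gam)%:E <= (c * r `^ (gam + Q))%:E)%E.
Proof.
move=> th0 t1; pose c0 := 2 `^ `|gam| * b * 2 `^ Q.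
have c00 : 0 < c0 by rewrite !mulr_gt0 ?powR_gt0.
have t0 : 0 < t by exact: powR_gt0.
exists (c0 / (1 - t)); first by rewrite divr_gt0// subr_gt0.
move=> r D r0 mD Dsub.
apply: le_trans (ge0_integral_subset_bigcup_le mu mD _ Dsub
  (measurable_powR_N_EFin gam) _) _ => [k|x|]; first exact: measurable_annulus.
  by rewrite lee_fin powR_ge0.
have rk k : 0 < r * th ^+ k by rewrite mulr_gt0// exprn_gt0.
apply: le_trans (lee_nneseries _ (fun k _ => integral_annulus_le gam (rk k))) _.
  by move=> k _ _; apply: integral_ge0 => x _; rewrite lee_fin powR_ge0.
apply: lime_le.
  apply: is_cvg_nneseries => k _ _; rewrite lee_fin.
  by rewrite !mulr_ge0 ?powR_ge0// ltW.
apply: nearW => m; rewrite sumEFin lee_fin.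
have -> : \sum_(0 <= k < m) c0 * (r * th ^+ k) `^ (gam + Q) =
    series (geometric (c0 * r `^ (gam + Q)) t) m.
  apply: eq_bigr => k _ /=; rewrite powRM ?(ltW r0) ?exprn_ge0 ?(ltW th0)//.
  rewrite -[RHS]mulrA; congr (_ * (_ * _)).
  by rewrite -(powR_mulrn _ (ltW th0)) -powRrM mulrC powRrM
    powR_mulrn// powR_ge0.
apply: le_trans (geometric_le_lim _ _ t0 _) _.
- by rewrite mulr_ge0 ?powR_ge0// ltW.
- by rewrite ger0_norm// ltW.
- by rewrite mulrAC.
Qed.

Lemma exists_pow2_gt (y : R) : exists k : nat, y < 2 ^+ k.
Proof.
exists (Num.trunc `|y|).+1; apply: (le_lt_trans (ler_norm y)).
apply: (lt_trans (truncnS_gt _)); rewrite -natrX ltr_nat.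
exact: ltn_expl.
Qed.

Lemma integral_punctured_ball_le gam : 0 < gam + Q ->
  exists2 c : R, 0 < c & forall r, 0 < r ->
    (\int[mu]_(x in [set x | (0 < N x < r)%R]) (N x `^ gam)%:E <=
     (c * r `^ (gam + Q))%:E)%E.
Proof.
move=> g0.
have h1 : (2^-1 : R) `^ (gam + Q) < 1.
  rewrite -[ltRHS](congr1 (@^~ (gam + Q)) (powR1 R)); apply: gt0_ltr_powR;
    rewrite ?nnegrE//.
  by rewrite invf_lt1// ltr1n.
have [//|c c0 H] := integral_geometric_annuli_le _ h1.
exists (c * 2^-1 `^ (gam + Q)); first by rewrite mulr_gt0 ?powR_gt0.
move=> r r0; rewrite -mulrA -powRM ?(ltW r0)//; apply: H.
- by rewrite mulr_gt0.
- rewrite -[X in measurable X]setTI.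
  by exact: (mN measurableT (measurable_itv `]0, r[%R)).
move=> x /= /andP[x0 xr].
have ex : exists k, r < N x * 2 ^+ k.+1.
  have [k ] := exists_pow2_gt (r / N x); rewrite ltr_pdivrMr// mulrC => H'.
  by exists k; rewrite (lt_le_trans H')// ler_pM2l// ler_eXn2l ?ltr1n.
have ex' : exists k, r <= N x * 2 ^+ k.+1 by have [k /ltW] := ex; exists k.
have [k kx kmin] := ex_minnP ex'.
have p0 : 0 < (2 ^+ k : R) by rewrite exprn_gt0.
have E1 : 2^-1 * r / 2 ^+ k = r / 2 ^+ k.+1 by rewrite exprS; field;
  rewrite gt_eqF.
have E2 : 2 * (2^-1 * r / 2 ^+ k) = r / 2 ^+ k by field; rewrite gt_eqF.
exists k => //; rewrite /annulus /= exprVn E2 E1; apply/andP; split.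
  by rewrite ler_pdivrMr// exprn_gt0.
rewrite ltr_pdivlMr//.
case: k kx kmin {p0 E1 E2} => [|k] kx kmin; first by rewrite expr0 mulr1.
by rewrite ltNge; apply/negP => /kmin; rewrite ltnn.
Qed.

Lemma integral_ball_compl_le gam : gam + Q < 0 ->
  exists2 c : R, 0 < c & forall r, 0 < r ->
    (\int[mu]_(x in [set x | (r <= N x)%R]) (N x `^ gam)%:E <=
     (c * r `^ (gam + Q))%:E)%E.
Proof.
move=> g0.
have h1 : (2 : R) `^ (gam + Q) < 1.
  rewrite -[gam + Q]opprK powRN invf_lt1 ?powR_gt0//.
  rewrite -[ltLHS](congr1 (@^~ (- (gam + Q))) (powR1 R)).
  by apply: gt0_ltr_powR; rewrite ?nnegrE ?oppr_gt0// ltr1n.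
have [//|c c0 H] := integral_geometric_annuli_le _ h1.
exists c => // r r0; apply: H => //.
  rewrite -[X in measurable X]setTI.
  rewrite (_ : [set x | r <= N x] = N @^-1` `[r, +oo[%classic); first exact: mN.
  by apply/seteqP; split => x /=; rewrite in_itv/= andbT.
move=> x /= rx.
have ex : exists k, N x < 2 * (r * 2 ^+ k).
  have [k] := exists_pow2_gt (N x / r); rewrite ltr_pdivrMr// mulrC => H'.
  by exists k; rewrite (lt_le_trans H')// ler_peMl ?mulr_ge0 ?exprn_ge0
    ?ler1n// ltW.
have [k kx kmin] := ex_minnP ex.
exists k => //; rewrite /annulus /= kx andbT.
case: k kx kmin => [|k] kx kmin; first by rewrite expr0 mulr1.
rewrite leNgt; apply/negP; rewrite exprS mulrCA => /kmin.
by rewrite ltnn.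
Qed.

(** For a large enough ratio lam, the measure of the annulus r <= N < lam r is
    at least r^Q. *)
Lemma exists_thick_annulus : exists2 lam : R, 1 < lam &
  forall r, 0 < r -> ((r `^ Q)%:E <= mu (annulus r (lam * r)))%E.
Proof.
(* The constant L = lam^Q makes the lower bound a L r^Q for the measure of
   the large ball exceed the upper bound b r^Q for the small one by more than
   r^Q. *)
pose L := (b + 1) / a + 1.
have L1 : 1 < L by rewrite ltrDr divr_gt0// addr_gt0.
have L0 : 0 < L by exact: lt_trans L1.
have lamQ : (L `^ Q^-1) `^ Q = L by rewrite -powRrM mulVf
  ?gt_eqF// powRr1// ltW.
have l1 : 1 < L `^ Q^-1.
  rewrite -[ltLHS](congr1 (@^~ (Q^-1)) (powR1 R)).
  by apply: gt0_ltr_powR; rewrite ?nnegrE ?invr_gt0 ?ler01 ?(ltW L0).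
exists (L `^ Q^-1) => // r r0.
have lr0 : 0 < L `^ Q^-1 * r by rewrite mulr_gt0// powR_gt0.
have := growth lr0; rewrite powRM ?powR_ge0 ?(ltW r0)// lamQ => /andP[low _].
have /andP[_ up] := growth r0.
have U : [set x | N x < L `^ Q^-1 * r] `<=` [set x | N x < r] `|` annulus r
  (L `^ Q^-1 * r).
  by move=> x /= xl; have [xr|xr] := ltP (N x) r;
    [left|right; rewrite /annulus/= xr].
have H : ((a * (L * r `^ Q))%:E <= (b * r `^ Q)%:E +
  mu (annulus r (L `^ Q^-1 * r)))%E.
  apply: (le_trans low).
  apply: (@le_trans _ _ (mu [set x | N x < r]%R +
    mu (annulus r (L `^ Q^-1 * r)))%E).
    apply: le_trans (measureU2 _ (measurable_sublevel _)
      (measurable_annulus _ _)).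
    apply: le_measure; rewrite ?inE//; first exact: measurable_sublevel.
    by apply: measurableU; [exact: measurable_sublevel|exact:
      measurable_annulus].
  by rewrite leeD2r.
rewrite -leeBlDl// -EFinB in H; apply: le_trans H; rewrite lee_fin.
have -> : a * (L * r `^ Q) - b * r `^ Q = (1 + a) * r `^ Q.
  by rewrite /L; field; rewrite gt_eqF.
by rewrite ler_peMl ?powR_ge0// lerDl ltW.
Qed.

(** The critical power N^(- Q) has a divergent integral at 0: each of the m
    thick annuli contributes at least a fixed constant. *)
Lemma integral_annulus_powRNQ_ge : exists lam c : R, [/\ 1 < lam, 0 < c &
  forall r m, 0 < r ->
   ((m%:R * c)%:E <= \int[mu]_(x in annulus r (lam ^+ m * r))
     (N x `^ (- Q))%:E)%E].
Proof.
have [lam lam1 H] := exists_thick_annulus.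
have lam0 : 0 < lam by exact: lt_trans lam1.
exists lam, (lam `^ (- Q)); split => //; first exact: powR_gt0.
move=> r m; elim: m r => [|m IH] r r0.
  by rewrite mul0r; apply: integral_ge0 => x _; rewrite lee_fin powR_ge0.
have lr0 : 0 < lam * r by rewrite mulr_gt0.
have lm : 1 <= lam ^+ m by rewrite exprn_ege1// ltW.
have UE : annulus r (lam ^+ m.+1 * r) =
    annulus r (lam * r) `|` annulus (lam * r) (lam ^+ m * (lam * r)).
  apply/seteqP; split => x; rewrite /annulus /= mulrA -exprSr.
    by move=> /andP[-> ->] /=; rewrite andbT; case: ltP; [left|right].
  move=> [/andP[-> xl]|/andP[xl ->]] /=; last first.
    by rewrite andbT (le_trans _ xl)// ler_peMl// ltW.
  rewrite (lt_le_trans xl)// exprSr -mulrA ler_peMl//.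
  exact: ltW.
rewrite UE ge0_integral_setU.
- rewrite -natr1 mulrDl mul1r addrC EFinD; apply: leeD; last exact: IH.
  apply: (@le_trans _ _ (\int[mu]_(x in annulus r (lam * r))
    (cst ((lam * r) `^ (- Q))%:E) x)%E).
    rewrite integral_cst; last exact: measurable_annulus.
    apply: (@le_trans _ _ (((lam * r) `^ (- Q))%:E * (r `^ Q)%:E)%E).
      rewrite -EFinM lee_fin powRM ?(ltW lam0) ?(ltW r0)//.
      by rewrite -mulrA -powRD ?addNr ?powRr0 ?mulr1 ?(gt_eqF r0) ?implybT.
    by rewrite lee_wpmul2l ?lee_fin ?powR_ge0// H.
  apply: ge0_le_integral; first exact: measurable_annulus.
  - by move=> x _; rewrite lee_fin powR_ge0.
  - by [].
  - exact: measurable_funTS (measurable_powR_N_EFin (- Q)).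
  - move=> x /andP[x1 x2]; rewrite lee_fin !powRN lef_pV2 ?posrE ?powR_gt0//.
      apply: ge0_ler_powR; rewrite ?nnegrE ?(ltW Q0) ?(ltW lr0) ?(ltW x2)//.
    exact: lt_le_trans x1.
- exact: measurable_annulus.
- exact: measurable_annulus.
- exact: measurable_funTS (measurable_powR_N_EFin (- Q)).
- by move=> x _; rewrite lee_fin powR_ge0.
- rewrite disj_set2E; apply/eqP/seteqP;
  split => // x /= [/andP[_ x1] /andP[x2 _]].
  by move: x1; rewrite ltNge x2.
Qed.

Lemma integral_powR_annulus_lty gam s t : 0 < s ->
  (\int[mu]_(x in annulus s t) (N x `^ gam)%:E < +oo)%E.
Proof.
move=> s0.
apply: (@le_lt_trans _ _ (\int[mu]_(x in annulus s t)
   (cst (s `^ gam + t `^ gam)%:E) x)%E).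
  apply: ge0_le_integral; first exact: measurable_annulus.
  - by move=> x _; rewrite lee_fin powR_ge0.
  - exact: measurable_funTS (measurable_powR_N_EFin gam).
  - by [].
  - move=> x /andP[x1 x2]; rewrite lee_fin.
    have x0 : 0 < N x by exact: lt_le_trans x1.
    have t0 : 0 < t by exact: lt_trans x2.
    have [g0|g0] := leP 0 gam.
      rewrite (@le_trans _ _ (t `^ gam))// ?lerDr ?powR_ge0//.
      by apply: ge0_ler_powR; rewrite ?nnegrE ?(ltW x0) ?(ltW t0) ?(ltW x2).
    rewrite (@le_trans _ _ (s `^ gam))// ?lerDl ?powR_ge0//.
    rewrite -[gam]opprK powRN [leRHS]powRN lef_pV2 ?posrE ?powR_gt0//.
    by apply: ge0_ler_powR; rewrite ?nnegrE ?oppr_ge0 ?(ltW g0) ?(ltW x0)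
      ?(ltW s0).
rewrite integral_cst; last exact: measurable_annulus.
rewrite lte_mul_pinfty ?lee_fin ?addr_ge0 ?powR_ge0//.
apply: le_lt_trans (mu_sublevel_lty t).
apply: le_measure; rewrite ?inE;
  [exact: measurable_annulus|exact: measurable_sublevel|].
by move=> x /andP[].
Qed.

End power_growth.

(** * Two-weight Hardy inequality *)

Section extended_powers.
Context (R : realType).
Implicit Types (x y : \bar R) (r : R).
Local Open Scope ereal_scope.

Lemma ge0_le_poweR x y r : (0 <= r)%R -> 0 <= x -> x <= y -> x `^ r <= y `^ r.
Proof.
move=> r0 x0 xy; apply: gt0_ler_poweR => //.
  by rewrite in_itv /= x0 leey.
by rewrite in_itv /= (le_trans x0 xy) leey.
Qed.

End extended_powers.

Section weighted_hoelder.
Context d (T : measurableType d) (R : realType)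
  (mu : {measure set T -> \bar R}).
Local Open Scope ereal_scope.

(** Hoelder's inequality on a set, for nonnegative functions. *)
Lemma hoelder_set (D : set T) (f g : T -> R) (p p' : R) :
    measurable D -> measurable_fun setT f -> measurable_fun setT g ->
    (forall x, 0 <= f x)%R -> (forall x, 0 <= g x)%R ->
    (0 < p)%R -> (0 < p')%R -> (p^-1 + p'^-1 = 1)%R ->
  \int[mu]_(x in D) (f x * g x)%:E <=
    (\int[mu]_(x in D) (f x `^ p)%:E) `^ p^-1 *
    (\int[mu]_(x in D) (g x `^ p')%:E) `^ p'^-1.
Proof.
move=> mD mf mg f0 g0 p0 p'0 pp'.
have mind : measurable_fun setT (\1_D : T -> R) by exact: measurable_indic.
have H := @hoelder _ _ _ mu (fun x => f x * \1_D x)%R (fun x => g x * \1_D x)%R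
  p p'
  (measurable_funM mf mind) (measurable_funM mg mind) p0 p'0 pp'.
move: H; rewrite Lnorm1 unlock /=.
have restr (h : T -> R) (r : R) : (0 < r)%R -> (forall x, 0 <= h x)%R ->
    \int[mu]_x (`|h x * \1_D x| `^ r)%:E = \int[mu]_(x in D) (h x `^ r)%:E.
  move=> r0 h0; rewrite [RHS]integral_mkcond; apply: eq_integral => x _.
  rewrite patchE indicE; case: ifPn => xD /=.
    by rewrite mulr1 ger0_norm.
  by rewrite mulr0 normr0 powR0// gt_eqF.
rewrite (restr f p p0 f0). rewrite (restr g p' p'0 g0); apply: le_trans.
rewrite integral_mkcond le_eqVlt; apply/orP; left; apply/eqP.
apply: eq_integral => x _; rewrite patchE indicE; case: ifPn => xD /=.
  by rewrite !mulr1 ger0_norm// mulr_ge0.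
by rewrite !mulr0 normr0.
Qed.

End weighted_hoelder.

Section tonelli_radial.
Context d (T : measurableType d) (R : realType).
Context (mu : {sigma_finite_measure set T -> \bar R}).
Context (N : T -> R).
Hypothesis mN : measurable_fun setT N.
Local Open Scope ereal_scope.

Let K : set (T * T) := [set z | (0 < N z.2 < N z.1)%R].

Let mK : measurable K.
Proof.
have m1 : measurable_fun setT (fun z : T * T => N z.1)
  by exact: measurableT_comp.
have m2 : measurable_fun setT (fun z : T * T => N z.2)
  by exact: measurableT_comp.
have mb : measurable_fun setT (fun z : T *
  T => (0 < N z.2)%R && (N z.2 < N z.1)%R).
  by apply: measurable_and; exact: measurable_fun_ltr.
rewrite -[X in measurable X]setTI (_ : K = (fun z : T * T =>
  (0 < N z.2)%R && (N z.2 < N z.1)%R) @^-1` [set true]); first exact: mb.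
by apply/seteqP; split => z.
Qed.

Variables (h w : T -> R).
Hypotheses (mh : measurable_fun setT h) (mw : measurable_fun setT w).
Hypotheses (h0 : forall x, (0 <= h x)%R) (w0 : forall x, (0 <= w x)%R).

Let k (z : T * T) : \bar R := (w z.1 * h z.2 * \1_K z)%:E.

Let mk : measurable_fun setT k.
Proof.
apply/measurable_EFinP; apply: measurable_funM; last exact: measurable_indic.
by apply: measurable_funM; exact: measurableT_comp.
Qed.

Let k0 z : 0 <= k z.
Proof. by rewrite lee_fin !mulr_ge0. Qed.

Let measurable_pball r : measurable [set y | (0 < N y < r)%R].
Proof.
rewrite -[X in measurable X]setTI.
by exact: (mN measurableT (measurable_itv `]0, r[%R)).
Qed.

Let measurable_compl r : measurable [set x | (r < N x)%R].
Proof.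
rewrite -[X in measurable X]setTI.
rewrite (_ : [set x | (r < N x)%R] = N @^-1` `]r, +oo[%classic);
  first exact: mN.
by apply/seteqP; split => x /=; rewrite in_itv/= andbT.
Qed.

Let kF x : \int[mu]_y k (x, y) =
  (w x)%:E * \int[mu]_(y in [set y | (0 < N y < N x)%R]) (h y)%:E.
Proof.
rewrite [X in _ * X]integral_mkcond -ge0_integralZl//.
- apply: eq_integral => y _; rewrite /k patchE indicE.
  rewrite (_ : ((x, y) \in K) = (y \in [set y | (0 < N y < N x)%R])).
    by case: ifPn => _ /=; rewrite ?mulr1// mulr0 mule0.
  by apply/idP/idP; rewrite !inE.
- apply/measurable_restrict => //.
  by apply: measurable_funTS; exact/measurable_EFinP.
- by move=> y _; apply: erestrict_ge0 => z _; rewrite lee_fin.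
- by rewrite lee_fin.
Qed.

Let kG y : \int[mu]_x k (x, y) =
  ((fun y => (h y)%:E * \int[mu]_(x in [set x | (N y < N x)%R]) (w x)%:E)
    \_ [set y | (0 < N y)%R]) y.
Proof.
rewrite patchE; case: ifPn => [|/negP] y0.
  rewrite [X in _ * X]integral_mkcond -ge0_integralZl//.
  - apply: eq_integral => x _; rewrite /k patchE indicE.
    rewrite (_ : ((x, y) \in K) = (x \in [set x | (N y < N x)%R])).
      by case: ifPn => _ /=; [rewrite mulr1 mulrC|rewrite mulr0 mule0].
    apply/idP/idP; rewrite !inE /K /=; first by case/andP.
    by move: y0; rewrite inE => /= -> ->.
  - apply/measurable_restrict => //.
    by apply: measurable_funTS; exact/measurable_EFinP.
  - by move=> x _; apply: erestrict_ge0 => z _; rewrite lee_fin.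
  - by rewrite lee_fin.
apply: integral0_eq => x _; rewrite /k indicE.
case: (boolP ((x, y) \in K)) => [|_]; last by rewrite mulr0.
by rewrite inE /K /= => /andP[yy _]; exfalso; apply: y0; rewrite inE.
Qed.

(** Tonelli's theorem on the set 0 < N y < N x. *)
Lemma tonelli_radial :
  \int[mu]_x ((w x)%:E * \int[mu]_(y in [set y | (0 < N y < N x)%R]) (h y)%:E) =
  \int[mu]_(y in [set y | (0 < N y)%R])
     ((h y)%:E * \int[mu]_(x in [set x | (N y < N x)%R]) (w x)%:E).
Proof.
rewrite [RHS]integral_mkcond -(funext kF) -(funext kG).
exact: fubini_tonelli.
Qed.

Lemma measurable_radial_integral :
  measurable_fun setT (fun x =>
    (w x)%:E * \int[mu]_(y in [set y | (0 < N y < N x)%R]) (h y)%:E).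
Proof.
by rewrite -(funext kF); exact: measurable_fun_fubini_tonelli_F.
Qed.

Lemma measurable_radial_integral_compl :
  measurable_fun [set y | (0 < N y)%R] (fun y =>
    (h y)%:E * \int[mu]_(x in [set x | (N y < N x)%R]) (w x)%:E).
Proof.
apply/measurable_restrictT; first exact: measurable_compl.
by rewrite -(funext kG); exact: measurable_fun_fubini_tonelli_G.
Qed.

End tonelli_radial.

Section hardy.
Context d (T : measurableType d) (R : realType).
Context (mu : {sigma_finite_measure set T -> \bar R}).
Context (N : T -> R) (Q a b : R).
Hypothesis mN : measurable_fun setT N.
Hypothesis N0 : forall x, 0 <= N x.
Hypotheses (Q0 : 0 < Q) (a0 : 0 < a) (b0 : 0 < b).
Hypothesis growth : forall r, 0 < r ->
  ((a * r `^ Q)%:E <= mu [set x | N x < r]%R <= (b * r `^ Q)%:E)%E.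

Local Open Scope ereal_scope.

(** The integral of f over the ball N < r. *)
Definition ball_integral (f : T -> R) (r : R) : \bar R :=
  \int[mu]_(x in [set x | (N x < r)%R]) (f x)%:E.

(** The p-th power of the weighted norm of f >= 0. *)
Definition weighted_integral (p beta : R) (f : T -> R) : \bar R :=
  \int[mu]_x (f x `^ p * N x `^ beta)%:E.

Lemma measurable_punctured_ball r : measurable [set y | (0 < N y < r)%R].
Proof.
rewrite -[X in measurable X]setTI.
by exact: (mN measurableT (measurable_itv `]0, r[%R)).
Qed.

Lemma measurable_radius_gt r : measurable [set x | (r < N x)%R].
Proof.
rewrite -[X in measurable X]setTI.
rewrite (_ : [set x | (r < N x)%R] = N @^-1` `]r, +oo[%classic);
  first exact: mN.
by apply/seteqP; split => x /=; rewrite in_itv/= andbT.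
Qed.

Lemma measurable_radius_ge r : measurable [set x | (r <= N x)%R].
Proof.
rewrite -[X in measurable X]setTI.
rewrite (_ : [set x | (r <= N x)%R] = N @^-1`
  `[r, +oo[%classic); first exact: mN.
by apply/seteqP; split => x /=; rewrite in_itv/= andbT.
Qed.

Lemma ball_integralE (f : T -> R) r : measurable_fun setT f ->
  (forall x, 0 <= f x)%R ->
  ball_integral f r = \int[mu]_(x in [set x | (0 < N x < r)%R]) (f x)%:E.
Proof.
move=> mf f0.
have mE : measurable [set x | N x = 0%R].
  by rewrite -[X in measurable X]setTI;
    exact: (mN measurableT (measurable_set1 _)).
rewrite /ball_integral (ge0_negligible_integral mE _ _ _
  (mu_N_eq0 mN Q0 b0 growth)).
- congr (integral _ _ _); apply/seteqP; split => x /= => [[xr x0]|/andP[x0 xr]].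
    by rewrite xr andbT lt_neqAle N0 andbT eq_sym; apply/eqP.
  by split => // x0'; move: x0; rewrite x0' ltxx.
- exact: measurable_sublevel.
- by apply: measurable_funTS; exact/measurable_EFinP.
- by move=> x _; rewrite lee_fin.
Qed.

Lemma ball_integral_ge0 (f : T -> R) r : (forall x, 0 <= f x)%R ->
  0 <= ball_integral f r.
Proof. by move=> f0; apply: integral_ge0 => x _; rewrite lee_fin. Qed.

Lemma measurable_ball_integral (f : T -> R) : measurable_fun setT f ->
  (forall x, 0 <= f x)%R ->
  measurable_fun setT (fun x => ball_integral f (N x)).
Proof.
move=> mf f0.
have := measurable_radial_integral mu mN mf (measurable_cst (1%R : R)) f0
  (fun=> ler01).
by under eq_fun do rewrite mul1e -ball_integralE//.
Qed.

Lemma measurable_weighted (p beta : R) (f : T -> R) : measurable_fun setT f ->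
  measurable_fun setT (fun x => f x `^ p * N x `^ beta)%R.
Proof.
move=> mf; apply: measurable_funM; last exact: measurable_powR_N.
exact: (measurableT_comp (measurable_powR p)).
Qed.

Lemma weighted_integral_ge0 p beta f : 0 <= weighted_integral p beta f.
Proof.
by apply: integral_ge0 => x _; rewrite lee_fin mulr_ge0 ?powR_ge0.
Qed.

Section exponents.
Variables (p p' beta : R).
Hypotheses (p0 : (0 < p)%R) (p'0 : (0 < p')%R) (pp' : (p^-1 + p'^-1 = 1)%R).

(** Hoelder's inequality with the weight N^s split off. *)
Lemma ball_integral_hoelder (s r : R) (f : T -> R) :
    measurable_fun setT f -> (forall x, 0 <= f x)%R ->
  ball_integral f r <=
    (\int[mu]_(x in [set x | (0 < N x < r)%R]) (f x `^ p * N x `^ (s * p))%:E)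
      `^ p^-1 *
    (\int[mu]_(x in [set x | (0 < N x < r)%R]) (N x `^ (- s * p'))%:E) `^ p'^-1.
Proof.
move=> mf f0; rewrite ball_integralE//.
have H := @hoelder_set _ _ _ mu [set x | (0 < N x < r)%R]
  (fun x => f x * N x `^ s)%R
  (fun x => N x `^ (- s))%R p p' (measurable_punctured_ball r)
  (measurable_funM mf (measurable_powR_N mN s)) (measurable_powR_N mN (- s)%R)
  (fun x => mulr_ge0 (f0 x) (powR_ge0 _ _)) (fun x => powR_ge0 _ _) p0 p'0 pp'.
apply: le_trans (le_trans H _).
  rewrite le_eqVlt; apply/orP; left; apply/eqP; apply: eq_integral => x.
  rewrite inE /= => /andP[x0 _].
  by rewrite powRN mulfK// gt_eqF// powR_gt0.
rewrite le_eqVlt; apply/orP; left; apply/eqP; congr (poweR _ _ * poweR _ _).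
  by apply: eq_integral => x _; rewrite powRM ?powR_ge0// -powRrM.
by apply: eq_integral => x _; rewrite -powRrM.
Qed.

Lemma conj_exponent : (- (beta / p) * p' = beta * (1 - p'))%R.
Proof.
have -> : (p^-1 = 1 - p'^-1)%R by rewrite -pp' addrK.
by field; rewrite gt_eqF.
Qed.

Let sigma : R := ((beta * (1 - p') + Q) / p')%R.

Lemma ball_integral_le : (0 < beta * (1 - p') + Q)%R ->
  exists2 c : R, (0 < c)%R & forall (f : T -> R) r,
    measurable_fun setT f -> (forall x, 0 <= f x)%R -> (0 < r)%R ->
    ball_integral f r <= (c * r `^ sigma)%:E *
      (weighted_integral p beta f) `^ p^-1.
Proof.
move=> g0; have [c c0 Hc] := integral_punctured_ball_le mN b0 growth g0.
exists (c `^ p'^-1)%R; first exact: powR_gt0.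
move=> f r mf f0 r0; apply: le_trans (ball_integral_hoelder (beta / p) r mf f0)
  _.
rewrite muleC; apply: lee_pmul; rewrite ?poweR_ge0//.
  rewrite conj_exponent /sigma powRrM -powRM ?powR_ge0 ?(ltW c0)// -poweR_EFin.
  apply: ge0_le_poweR; [by rewrite invr_ge0 ltW| |exact: Hc].
  by apply: integral_ge0 => x _; rewrite lee_fin powR_ge0.
apply: ge0_le_poweR; first by rewrite invr_ge0 ltW.
  by apply: integral_ge0 => x _; rewrite lee_fin mulr_ge0 ?powR_ge0.
rewrite divfK ?gt_eqF//; apply: ge0_subset_integral => //.
- exact: measurable_punctured_ball.
- exact/measurable_EFinP/measurable_weighted.
- by move=> x _; rewrite lee_fin mulr_ge0 ?powR_ge0.
Qed.

(** Schur test: the weight N^s in Hoelder's inequality, with s larger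
    than beta / p, makes the integral in x obtained after Tonelli's theorem
    converge. *)
Lemma hardy_inequality : (0 < beta * (1 - p') + Q)%R ->
  exists2 c : R, (0 < c)%R & forall f : T -> R,
    measurable_fun setT f -> (forall x, 0 <= f x)%R ->
    \int[mu]_x ((ball_integral f (N x)) `^ p * (N x `^ (- Q - sigma * p))%:E) <=
    c%:E * weighted_integral p beta f.
Proof.
move=> g0; have s0 : (0 < sigma)%R by rewrite divr_gt0.
(* Any eta strictly between 0 and sigma would do. *)
pose eta := (sigma / 2)%R; pose s := (beta / p + eta)%R.
have e0 : (0 < eta)%R by rewrite divr_gt0.
have es : (sigma = eta + eta)%R by rewrite /eta -splitr.
have sp' : (- s * p' + Q = eta * p')%R.
  rewrite /s opprD mulrDl conj_exponent.
  have -> : (beta * (1 - p') = sigma * p' - Q)%R by rewrite divfK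
    ?gt_eqF// addrK.
  by rewrite es; ring.
have g1 : (0 < - s * p' + Q)%R by rewrite sp' mulr_gt0.
have g2 : (- Q - eta * p + Q < 0)%R by rewrite addrAC addNr add0r oppr_lt0
  mulr_gt0.
have [c1 c10 H1] := integral_punctured_ball_le mN b0 growth g1.
have [c2 c20 H2] := integral_ball_compl_le mN b0 growth g2.
pose C1 := (c1 `^ (p / p'))%R.
have C10 : (0 < C1)%R by exact: powR_gt0.
exists (C1 * c2)%R; first by rewrite mulr_gt0.
move=> f mf f0.
pose h x := (f x `^ p * N x `^ (s * p))%R.
have mh : measurable_fun setT h by exact: measurable_weighted.
have h0 x : (0 <= h x)%R by rewrite mulr_ge0 ?powR_ge0.
pose w x := (N x `^ (- Q - eta * p))%R.
have mw : measurable_fun setT w by exact: measurable_powR_N.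
have w0 x : (0 <= w x)%R by exact: powR_ge0.
have wh0 x : 0 <= (w x)%:E * \int[mu]_(y in [set y | (0 < N y < N x)%R])
  (h y)%:E.
  by rewrite mule_ge0 ?lee_fin//; apply: integral_ge0 => y _; rewrite lee_fin.
have mwh := measurable_radial_integral mu mN mh mw h0 w0.
apply: (@le_trans _ _ (\int[mu]_x (C1%:E *
    ((w x)%:E * \int[mu]_(y in [set y | (0 < N y < N x)%R]) (h y)%:E)))).
  apply: ge0_le_integral => //.
  - by move=> x _; rewrite mule_ge0 ?poweR_ge0 ?lee_fin ?powR_ge0.
  - apply: emeasurable_funM; last exact: measurable_powR_N_EFin.
    by apply: (measurableT_comp (measurable_poweR p));
      exact: measurable_ball_integral.
  - by apply: emeasurable_funM => //; exact: measurable_cst.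
  move=> x _; have [x0|x0] := leP (N x) 0%R.
    have -> : ball_integral f (N x) = 0.
      apply: integral0_eq => y /= yx; exfalso.
      by move: (lt_le_trans yx x0); rewrite ltNge N0.
    by rewrite poweR0r ?gt_eqF// mul0e mule_ge0// lee_fin ltW.
  have H := ball_integral_hoelder s (N x) mf f0.
  have {}H := ge0_le_poweR (ltW p0) (ball_integral_ge0 _ f0) H.
  apply: (@le_trans _ _ ((\int[mu]_(y in [set y | (0 < N y < N x)%R]) (h y)%:E *
      (C1 * N x `^ (eta * p))%:E) * (N x `^ (- Q - sigma * p))%:E)).
    apply: lee_wpmul2r; first by rewrite lee_fin powR_ge0.
    apply: (le_trans H); rewrite poweRM ?poweR_ge0// -!poweRrM.
    rewrite mulVf ?gt_eqF// poweRe1; last first.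
      by apply: integral_ge0 => y _; rewrite lee_fin mulr_ge0 ?powR_ge0.
    apply: lee_wpmul2l.
      by apply: integral_ge0 => y _; rewrite lee_fin mulr_ge0 ?powR_ge0.
    have -> : (C1 * N x `^ (eta * p) = (c1 * N x `^ (eta * p'))
      `^ (p'^-1 * p))%R.
      rewrite powRM ?powR_ge0 ?(ltW c10)// -powRrM /C1.
      congr (powR _ _ * powR _ _)%R; first by rewrite mulrC.
      by field; rewrite gt_eqF.
    rewrite -poweR_EFin -sp'; apply: ge0_le_poweR; last exact: H1.
      by rewrite mulr_ge0 ?invr_ge0 ?(ltW p'0) ?(ltW p0).
    by apply: integral_ge0 => y _; rewrite lee_fin powR_ge0.
  rewrite -muleA -EFinM muleC muleA -EFinM.
  have -> : (C1 * N x `^ (eta * p) * N x `^ (- Q - sigma * p) = C1 * w x)%R.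
    rewrite -mulrA -powRD ?(gt_eqF x0) ?implybT//; congr (_ * powR _ _)%R.
    by rewrite es; ring.
  by [].
rewrite ge0_integralZl//; last by rewrite lee_fin ltW.
rewrite EFinM -muleA; apply: lee_wpmul2l; first by rewrite lee_fin ltW.
rewrite (tonelli_radial mu mN mh mw h0 w0).
have mpos := measurable_radius_gt 0%R.
apply: (@le_trans _ _ (\int[mu]_(y in [set y | (0 < N y)%R])
    (c2%:E * (f y `^ p * N y `^ beta)%:E))).
  apply: ge0_le_integral => //.
  - move=> y _; rewrite mule_ge0 ?lee_fin//.
    by apply: integral_ge0 => x _; rewrite lee_fin.
  - exact: (measurable_radial_integral_compl mu mN mh mw h0 w0).
  - apply: measurable_funTS; apply: emeasurable_funM;
    first exact: measurable_cst.
    exact/measurable_EFinP/measurable_weighted.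
  move=> y /= y0.
  apply: (@le_trans _ _ ((h y)%:E * (c2 * N y `^ (- Q - eta * p + Q))%:E)).
    apply: lee_wpmul2l; first by rewrite lee_fin.
    apply: le_trans (H2 _ y0); apply: ge0_subset_integral => //.
    - exact: measurable_radius_gt.
    - exact: measurable_radius_ge.
    - exact: measurable_funTS (measurable_powR_N_EFin mN _).
    - by move=> x _; rewrite lee_fin powR_ge0.
    - by move=> x /= /ltW.
  rewrite -!EFinM lee_fin le_eqVlt; apply/orP; left; apply/eqP.
  rewrite /h mulrCA -mulrA -powRD ?(gt_eqF y0) ?implybT//;
    congr (_ * (_ * powR _ _))%R.
  by rewrite /s; field; rewrite gt_eqF.
rewrite ge0_integralZl//.
- apply: lee_wpmul2l; first by rewrite lee_fin ltW.
  apply: ge0_subset_integral => //.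
  + exact/measurable_EFinP/measurable_weighted.
  + by move=> x _; rewrite lee_fin mulr_ge0 ?powR_ge0.
- by apply: measurable_funTS; exact/measurable_EFinP/measurable_weighted.
- by move=> x _; rewrite lee_fin mulr_ge0 ?powR_ge0.
- by rewrite lee_fin ltW.
Qed.

End exponents.

(** The bilinear inequality with constant C, for nonnegative real functions. *)
Definition bilinear_hardy (p1 p2 q alpha beta1 beta2 C : R) : Prop :=
  forall f1 f2 : T -> R,
  measurable_fun setT f1 -> (forall x, 0 <= f1 x)%R ->
  measurable_fun setT f2 -> (forall x, 0 <= f2 x)%R ->
  (\int[mu]_x ((ball_integral f1 (N x) * ball_integral f2 (N x)) `^ q *
      (N x `^ alpha)%:E)) `^ (q^-1)%R
    <= C%:E * (weighted_integral p1 beta1 f1) `^ (p1^-1)%R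
            * (weighted_integral p2 beta2 f2) `^ (p2^-1)%R.

End hardy.

(** * Sufficiency *)

Section bilinear_sufficient.
Context d (T : measurableType d) (R : realType).
Context (mu : {sigma_finite_measure set T -> \bar R}).
Context (N : T -> R) (Q a b : R).
Hypothesis mN : measurable_fun setT N.
Hypothesis N0 : forall x, 0 <= N x.
Hypotheses (Q0 : 0 < Q) (a0 : 0 < a) (b0 : 0 < b).
Hypothesis growth : forall r, 0 < r ->
  ((a * r `^ Q)%:E <= mu [set x | N x < r]%R <= (b * r `^ Q)%:E)%E.
Context (p1 p1' p2 p2' q alpha beta1 beta2 : R).
Hypotheses (p10 : 0 < p1) (p1'0 : 0 < p1') (pp1 : p1^-1 + p1'^-1 = 1).
Hypotheses (p20 : 0 < p2) (p2'0 : 0 < p2') (pp2 : p2^-1 + p2'^-1 = 1).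
Hypotheses (p1q : p1 <= q).
Let sigma1 := (beta1 * (1 - p1') + Q) / p1'.
Let sigma2 := (beta2 * (1 - p2') + Q) / p2'.
Hypotheses (g1 : 0 < beta1 * (1 - p1') + Q) (g2 : 0 < beta2 * (1 - p2') + Q).
Hypothesis balance : (alpha + Q) / q + sigma1 + sigma2 = 0.
Local Notation BI := (ball_integral mu N).
Local Notation WI := (weighted_integral mu N).

Let q0 : 0 < q. Proof. exact: lt_le_trans p1q. Qed.

(** Bounds F_2^q and F_1^(q - p_1) by their pointwise estimates, at a point of
    gauge r where F_1 = v and F_2 = w. *)
Lemma bilinear_pointwise (c1 c2 x1 x2 v w r : R) :
    0 <= c1 -> 0 <= c2 -> 0 <= x1 -> 0 <= x2 -> 0 <= v -> 0 <= w -> 0 < r ->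
    v <= c1 * r `^ sigma1 * x1 -> w <= c2 * r `^ sigma2 * x2 ->
  (v * w) `^ q * r `^ alpha <=
  (c2 * x2) `^ q * (c1 * x1) `^ (q - p1) * (v `^ p1 * r `^ (- Q - sigma1 * p1)).
Proof.
move=> c10 c20 x10 x20 v0 w0 r0 vle wle.
have qp : 0 <= q - p1 by rewrite subr_ge0.
rewrite powRM//.
have -> : v `^ q = v `^ p1 * v `^ (q - p1).
  by rewrite -powRD addrC subrK// (gt_eqF q0).
have H1 : v `^ (q - p1) <= (c1 * x1) `^ (q - p1) * r `^ (sigma1 * (q - p1)).
  rewrite [r `^ _]powRrM -powRM ?powR_ge0 ?mulr_ge0// mulrAC.
  by apply: ge0_ler_powR; rewrite ?nnegrE ?mulr_ge0 ?powR_ge0.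
have H2 : w `^ q <= (c2 * x2) `^ q * r `^ (sigma2 * q).
  rewrite [r `^ _]powRrM -powRM ?powR_ge0 ?mulr_ge0// mulrAC.
  by apply: ge0_ler_powR; rewrite ?nnegrE ?mulr_ge0 ?powR_ge0// ltW.
have rE : r `^ (- Q - sigma1 * p1) =
    r `^ (sigma1 * (q - p1)) * r `^ (sigma2 * q) * r `^ alpha.
  rewrite -!powRD ?(gt_eqF r0) ?implybT//; congr powR.
  have : ((alpha + Q) / q + sigma1 + sigma2) * q = 0 by rewrite balance mul0r.
  rewrite 2!mulrDl divfK ?gt_eqF// [sigma1 * (q - p1)]mulrBr.
  by move: (sigma1 * q) (sigma2 * q) (sigma1 * p1) => X Y Z E; lra.
rewrite rE.
have -> : (c2 * x2) `^ q * (c1 * x1) `^ (q - p1) * (v `^ p1 *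
    (r `^ (sigma1 * (q - p1)) * r `^ (sigma2 * q) * r `^ alpha)) =
  v `^ p1 * ((c1 * x1) `^ (q - p1) * r `^ (sigma1 * (q - p1))) *
    ((c2 * x2) `^ q * r `^ (sigma2 * q)) * r `^ alpha by ring.
apply: ler_wpM2r; first exact: powR_ge0.
apply: ler_pM; rewrite ?mulr_ge0 ?powR_ge0//.
by apply: ler_wpM2l; rewrite ?powR_ge0.
Qed.

(** The degenerate cases, where a weighted norm is zero or infinite, are
    disposed of first. *)
Lemma bilinear_sufficient : exists2 C : R, 0 < C &
  bilinear_hardy mu N p1 p2 q alpha beta1 beta2 C.
Proof.
have [c1 c10 H1] := ball_integral_le mN N0 Q0 b0 growth p10 p1'0 pp1 g1.
have [c2 c20 H2] := ball_integral_le mN N0 Q0 b0 growth p20 p2'0 pp2 g2.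
have [c3 c30 H3] := hardy_inequality mN N0 Q0 b0 growth p10 p1'0 pp1 g1.
pose C := (c2 `^ q * c1 `^ (q - p1) * c3) `^ q^-1.
exists C; first by rewrite powR_gt0// !mulr_gt0// powR_gt0.
move=> f1 f2 mf1 f10 mf2 f20.
set A1 := (WI p1 beta1 f1 `^ p1^-1)%E; set A2 := (WI p2 beta2 f2 `^ p2^-1)%E.
have A10 : (0 <= A1)%E by exact: poweR_ge0.
have A20 : (0 <= A2)%E by exact: poweR_ge0.
have u0 x := ball_integral_ge0 mu N (N x) f10.
have w0 x := ball_integral_ge0 mu N (N x) f20.
have Nx0 f x : N x <= 0 -> BI f (N x) = 0%E.
  move=> x0; apply: integral0_eq => y /= yx; exfalso.
  by move: (lt_le_trans yx x0); rewrite ltNge N0.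
have zero : (forall x, BI f1 (N x) * BI f2 (N x) = 0)%E ->
    ((\int[mu]_x ((BI f1 (N x) * BI f2 (N x)) `^ q * (N x `^ alpha)%:E))
      `^ q^-1 = 0)%E.
  move=> z; rewrite integral0_eq ?poweR0r ?invr_neq0 ?gt_eqF// => x _.
  by rewrite z poweR0r ?gt_eqF// mul0e.
have [A1z|A1nz] := eqVneq A1 0%E.
  rewrite zero ?mule_ge0 ?lee_fin ?powR_ge0// => x.
  have [x0|x0] := leP (N x) 0; first by rewrite Nx0// mul0e.
  have := H1 f1 (N x) mf1 f10 x0; rewrite -/A1 A1z mule0 => u_le0.
  suff -> : BI f1 (N x) = 0%E by rewrite mul0e.
  by apply/eqP; rewrite eq_le u_le0 u0.
have [A2z|A2nz] := eqVneq A2 0%E.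
  rewrite zero ?mule_ge0 ?lee_fin ?powR_ge0// => x.
  have [x0|x0] := leP (N x) 0; first by rewrite Nx0// mul0e.
  have := H2 f2 (N x) mf2 f20 x0; rewrite -/A2 A2z mule0 => u_le0.
  suff -> : BI f2 (N x) = 0%E by rewrite mule0.
  by apply/eqP; rewrite eq_le u_le0 w0.
have A1p : (0 < A1)%E by rewrite lt0e A1nz.
have A2p : (0 < A2)%E by rewrite lt0e A2nz.
have C0 : 0 < C by rewrite powR_gt0// !mulr_gt0// powR_gt0.
have CA1 : (0 < C%:E * A1)%E by rewrite mule_gt0// lte_fin.
have [A2y|A2y] := eqVneq A2 +oo%E; first by rewrite A2y gt0_muley// leey.
have [A1y|A1y] := eqVneq A1 +oo%E.
  by rewrite A1y gt0_muley ?lte_fin// gt0_mulye// leey.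
have [x1 x1E] : exists x1 : R, A1 = x1%:E.
  by exists (fine A1); rewrite fineK// ge0_fin_numE// lt_neqAle A1y leey.
have [x2 x2E] : exists x2 : R, A2 = x2%:E.
  by exists (fine A2); rewrite fineK// ge0_fin_numE// lt_neqAle A2y leey.
have x10 : 0 < x1 by rewrite -lte_fin -x1E.
have x20 : 0 < x2 by rewrite -lte_fin -x2E.
have WE : WI p1 beta1 f1 = (x1 `^ p1)%:E.
  by rewrite -poweR_EFin -x1E /A1 -poweRrM mulVf ?gt_eqF// poweRe1//
     weighted_integral_ge0.
pose K := (c2 * x2) `^ q * (c1 * x1) `^ (q - p1).
have K0 : 0 <= K by rewrite mulr_ge0 ?powR_ge0.
have mu1 := measurable_ball_integral mN N0 Q0 b0 growth mf1 f10.
have mu2 := measurable_ball_integral mN N0 Q0 b0 growth mf2 f20.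
have int_le : (\int[mu]_x ((BI f1 (N x) * BI f2 (N x)) `^ q * (N x `^ alpha)%:E)
  <=
    (K * (c3 * x1 `^ p1))%:E)%E.
  apply: (@le_trans _ _ (\int[mu]_x (K%:E *
     (BI f1 (N x) `^ p1 * (N x `^ (- Q - sigma1 * p1))%:E)))%E).
    apply: ge0_le_integral => //.
    - by move=> x _; rewrite mule_ge0 ?poweR_ge0 ?lee_fin ?powR_ge0.
    - apply: emeasurable_funM; last exact: measurable_powR_N_EFin.
      apply: (measurableT_comp (measurable_poweR q)).
      exact: emeasurable_funM.
    - apply: emeasurable_funM; first exact: measurable_cst.
      apply: emeasurable_funM; last exact: measurable_powR_N_EFin.
      exact: (measurableT_comp (measurable_poweR p1)).
    move=> x _; have [x0|x0] := leP (N x) 0.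
      apply: (@le_trans _ _ 0%E);
        first by rewrite Nx0// mul0e poweR0r ?gt_eqF// mul0e.
      rewrite mule_ge0 ?lee_fin//.
      by rewrite mule_ge0 ?poweR_ge0 ?lee_fin ?powR_ge0.
    have := H1 f1 (N x) mf1 f10 x0; rewrite -/A1 x1E -EFinM.
    have := H2 f2 (N x) mf2 f20 x0; rewrite -/A2 x2E -EFinM.
    move: (u0 x) (w0 x); case: (BI f1 (N x)) => [v| |]//;
      case: (BI f2 (N x)) => [w| |]//.
    rewrite lee_fin => v0; rewrite lee_fin => w0'.
    rewrite lee_fin => wle; rewrite lee_fin => vle.
    rewrite -EFinM !poweR_EFin -!EFinM lee_fin.
    by apply: bilinear_pointwise => //; rewrite ltW.
  rewrite ge0_integralZl//.
  - rewrite [leRHS]EFinM; apply: lee_wpmul2l; first by rewrite lee_fin.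
    by apply: (le_trans (H3 f1 mf1 f10)); rewrite WE.
  - apply: emeasurable_funM; last exact: measurable_powR_N_EFin.
    exact: (measurableT_comp (measurable_poweR p1)).
  - by move=> x _; rewrite mule_ge0 ?poweR_ge0 ?lee_fin ?powR_ge0.
have qi0 : 0 <= q^-1 by rewrite invr_ge0 ltW.
apply: le_trans (ge0_le_poweR qi0 _ int_le) _.
  by apply: integral_ge0 => x _; rewrite mule_ge0 ?poweR_ge0 ?lee_fin ?powR_ge0.
rewrite x1E x2E -!EFinM poweR_EFin lee_fin le_eqVlt; apply/orP; left; apply/eqP.
have -> : K * (c3 * x1 `^ p1) = (c2 `^ q * c1 `^ (q - p1) * c3) *
  (x1 * x2) `^ q.
  have E : x1 `^ q = x1 `^ (q - p1) * x1 `^ p1.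
    by rewrite -powRD ?subrK// (gt_eqF x10) implybT.
  rewrite /K !powRM ?(ltW c10) ?(ltW c20) ?(ltW x10) ?(ltW x20)// E; ring.
rewrite powRM ?powR_ge0 ?mulr_ge0 ?powR_ge0 ?(ltW c30)// -/C -mulrA;
  congr (_ * _).
by rewrite -powRrM mulfV ?gt_eqF// powRr1// mulr_ge0// ltW.
Qed.

End bilinear_sufficient.

(** * Necessity *)

(** Two powers comparable on the whole half-line have the same exponent. *)
Lemma powR_le_eq_exponent (R : realType) (k1 k2 A B : R) : 0 < k1 -> 0 < k2 ->
  (forall r : R, 0 < r -> k1 * r `^ A <= k2 * r `^ B) -> A = B.
Proof.
move=> k10 k20 H; apply/eqP; apply: contraT => AB.
have BA : B - A != 0 by rewrite subr_eq0 eq_sym.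
pose t := k1 / (2 * k2).
have t0 : 0 < t by rewrite divr_gt0// mulr_gt0.
have r0 : 0 < t `^ (B - A)^-1 by exact: powR_gt0.
have := H _ r0.
have -> : (t `^ (B - A)^-1) `^ B = t * (t `^ (B - A)^-1) `^ A.
  rewrite -[X in X * _](powRr1 (ltW t0)) -!powRrM -powRD ?(gt_eqF t0)
    ?implybT//.
  by congr powR; field.
rewrite mulrA ler_pM2r ?powR_gt0// /t => le.
have : k1 <= k1 / 2.
  by apply: (le_trans le); rewrite le_eqVlt; apply/orP; left; apply/eqP; field;
    rewrite gt_eqF.
by move: k10; lra.
Qed.

Section necessity.
Context d (T : measurableType d) (R : realType).
Context (mu : {sigma_finite_measure set T -> \bar R}).
Context (N : T -> R) (Q a b : R).
Hypothesis mN : measurable_fun setT N.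
Hypothesis N0 : forall x, 0 <= N x.
Hypotheses (Q0 : 0 < Q) (a0 : 0 < a) (b0 : 0 < b).
Hypothesis growth : forall r, 0 < r ->
  ((a * r `^ Q)%:E <= mu [set x | N x < r]%R <= (b * r `^ Q)%:E)%E.
Local Notation BI := (ball_integral mu N).
Local Notation WI := (weighted_integral mu N).
Local Notation A := (annulus N).

Lemma ball_integral_full (f : T -> R) (rho r : R) : measurable_fun setT f ->
    (forall x, rho <= N x -> f x = 0) -> rho <= r ->
  BI f r = (\int[mu]_x (f x)%:E)%E.
Proof.
move=> mf fz rr; rewrite /ball_integral integral_mkcond;
  apply: eq_integral => x _.
rewrite patchE; case: ifPn => // /negP xr; rewrite fz//.
by apply: (le_trans rr); rewrite leNgt; apply/negP => xr'; apply: xr;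
  rewrite inE.
Qed.

Section annulus_bounds.
Variables (lam gam : R).
Hypothesis lam1 : 1 < lam.

Lemma annulus_powR_bounds r x : 0 < r -> A r (lam * r) x ->
  Num.min 1 (lam `^ gam) * r `^ gam <= N x `^ gam <= (1 + lam `^ gam) *
    r `^ gam.
Proof.
move=> r0 /andP[rx xr].
have lam0 : 0 < lam by exact: lt_trans lam1.
have x0 : 0 < N x by exact: lt_le_trans rx.
have lr0 : 0 < lam * r by rewrite mulr_gt0.
have lrE : lam `^ gam * r `^ gam = (lam * r) `^ gam by rewrite powRM ?ltW.
have [g0|g0] := leP 0 gam.
  apply/andP; split.
    apply: (@le_trans _ _ (1 * r `^ gam)).
      by rewrite ler_wpM2r ?powR_ge0// ge_min lexx.
    by rewrite mul1r; apply: ge0_ler_powR; rewrite ?nnegrE ?(ltW r0) ?(ltW x0).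
  rewrite mulrDl lrE mul1r (@le_trans _ _ ((lam * r) `^ gam))//; last first.
    by rewrite lerDr powR_ge0.
  by apply: ge0_ler_powR; rewrite ?nnegrE ?(ltW x0) ?(ltW lr0) ?(ltW xr).
have mono (y z : R) : 0 < y -> y <= z -> z `^ gam <= y `^ gam.
  move=> y0 yz; have z0 : 0 < z by exact: lt_le_trans yz.
  rewrite -[gam]opprK powRN [leRHS]powRN lef_pV2 ?posrE ?powR_gt0//.
  by apply: ge0_ler_powR; rewrite ?nnegrE ?oppr_ge0 ?(ltW g0) ?(ltW y0)
    ?(ltW z0).
apply/andP; split.
  apply: (@le_trans _ _ (lam `^ gam * r `^ gam)).
    by rewrite ler_wpM2r ?powR_ge0// ge_min lexx orbT.
  by rewrite lrE mono// ltW.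
by rewrite mulrDl mul1r (le_trans (mono _ _ r0 rx))// lerDl mulr_ge0 ?powR_ge0.
Qed.

Lemma integral_annulus_upper : exists2 c : R, 0 < c & forall r, 0 < r ->
  (\int[mu]_(x in A r (lam * r)) (N x `^ gam)%:E <= (c * r `^ (gam + Q))%:E)%E.
Proof.
have lam0 : 0 < lam by exact: lt_trans lam1.
exists ((1 + lam `^ gam) * (b * lam `^ Q)).
  by rewrite !mulr_gt0 ?powR_gt0// ltr_pwDl ?powR_ge0.
move=> r r0; have mA := measurable_annulus mN r (lam * r).
apply: (@le_trans _ _ (\int[mu]_(x in A r (lam * r))
   (cst ((1 + lam `^ gam) * r `^ gam)%:E) x)%E).
  apply: ge0_le_integral => //.
  - by move=> x _; rewrite lee_fin powR_ge0.
  - exact: measurable_funTS (measurable_powR_N_EFin mN gam).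
  - by move=> x Ax; rewrite lee_fin; have /andP[] := annulus_powR_bounds r0 Ax.
rewrite integral_cst//.
have -> : (1 + lam `^ gam) * (b * lam `^ Q) * r `^ (gam + Q) =
    ((1 + lam `^ gam) * r `^ gam) * (b * (lam * r) `^ Q).
  rewrite powRM ?(ltW r0) ?(ltW lam0)// powRD ?(gt_eqF r0) ?implybT//; ring.
rewrite [leRHS]EFinM; apply: lee_wpmul2l.
  by rewrite lee_fin mulr_ge0 ?addr_ge0 ?powR_ge0.
have lr0 : 0 < lam * r by rewrite mulr_gt0.
have /andP[_ H] := growth lr0; apply: le_trans H.
apply: le_measure; rewrite ?inE//; first exact: measurable_sublevel.
by move=> x /= /andP[].
Qed.

Lemma integral_annulus_lower :
    (forall r, 0 < r -> ((r `^ Q)%:E <= mu (A r (lam * r)))%E) ->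
  exists2 c : R, 0 < c & forall r, 0 < r ->
  ((c * r `^ (gam + Q))%:E <= \int[mu]_(x in A r (lam * r)) (N x `^ gam)%:E)%E.
Proof.
have lam0 : 0 < lam by exact: lt_trans lam1.
move=> thick; exists (Num.min 1 (lam `^ gam)).
  by rewrite lt_min ltr01 powR_gt0.
have m0 : 0 <= Num.min 1 (lam `^ gam) by rewrite le_min ler01 powR_ge0.
move=> r r0; have mA := measurable_annulus mN r (lam * r).
apply: (@le_trans _ _ (\int[mu]_(x in A r (lam * r))
   (cst (Num.min 1 (lam `^ gam) * r `^ gam)%:E) x)%E).
  rewrite integral_cst// powRD ?(gt_eqF r0) ?implybT// mulrA [leLHS]EFinM.
  apply: lee_wpmul2l; last exact: thick.
  by rewrite lee_fin mulr_ge0 ?powR_ge0.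
apply: ge0_le_integral => //.
- by move=> x _; rewrite lee_fin mulr_ge0 ?powR_ge0.
- exact: measurable_funTS (measurable_powR_N_EFin mN gam).
- by move=> x Ax; rewrite lee_fin; have /andP[] := annulus_powR_bounds r0 Ax.
Qed.

End annulus_bounds.

(** The test functions: N^s restricted to the annulus r <= N < t. *)
Definition annular_power (s r t : R) (x : T) : R := N x `^ s * \1_(A r t) x.

Lemma measurable_annular_power s r t : measurable_fun setT
  (annular_power s r t).
Proof.
apply: measurable_funM; first exact: measurable_powR_N.
by apply: measurable_indic; exact: measurable_annulus.
Qed.

Lemma annular_power_ge0 s r t x : 0 <= annular_power s r t x.
Proof. by rewrite mulr_ge0 ?powR_ge0. Qed.

Lemma annular_power_eq0 s r t x : t <= N x -> annular_power s r t x = 0.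
Proof.
move=> tx; rewrite /annular_power indicE memNset ?mulr0//.
by rewrite /annulus /= => /andP[_]; rewrite ltNge tx.
Qed.

Lemma integral_annular_power s r t :
  (\int[mu]_x (annular_power s r t x)%:E = \int[mu]_(x in A r t)
    (N x `^ s)%:E)%E.
Proof.
rewrite [RHS]integral_mkcond; apply: eq_integral => x _.
rewrite patchE /annular_power indicE; case: ifPn => _ /=;
  first by rewrite mulr1.
by rewrite mulr0.
Qed.

Lemma weighted_integral_annular_power p beta s r t : 0 < p -> 0 < r ->
  (WI p beta (annular_power s r t) =
   \int[mu]_(x in A r t) (N x `^ (s * p + beta))%:E)%E.
Proof.
move=> p0 r0; rewrite [RHS]integral_mkcond; apply: eq_integral => x _.
rewrite patchE /annular_power indicE; case: ifPn => /= [|_]; last first.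
  by rewrite mulr0 powR0 ?gt_eqF// mul0r.
rewrite inE => /andP[rx _]; have x0 : 0 < N x by exact: lt_le_trans rx.
by rewrite mulr1 -powRrM -powRD// (gt_eqF x0) implybT.
Qed.

Context (p1 p2 q alpha beta1 beta2 : R).

Section lower_bound.
Hypothesis q0 : 0 < q.
Context (C : R).
Hypothesis ineq : bilinear_hardy mu N p1 p2 q alpha beta1 beta2 C.

(** If f_1 and f_2 vanish outside the ball N < rho, then their integrals over
    the ball of radius N x are the full integrals as soon as N x >= rho. *)
Lemma bilinear_lower_bound (f1 f2 : T -> R) (rho : R) (D : set T) :
  measurable_fun setT f1 -> (forall x, 0 <= f1 x) ->
  measurable_fun setT f2 -> (forall x, 0 <= f2 x) ->
  (forall x, rho <= N x -> f1 x = 0) -> (forall x, rho <= N x -> f2 x = 0) ->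
  measurable D -> (forall x, D x -> rho <= N x) ->
  ((\int[mu]_x (f1 x)%:E * \int[mu]_x (f2 x)%:E) *
    (\int[mu]_(x in D) (N x `^ alpha)%:E) `^ (q^-1)%R
   <= C%:E * (WI p1 beta1 f1) `^ (p1^-1)%R * (WI p2 beta2 f2) `^ (p2^-1)%R)%E.
Proof.
move=> mf1 f10 mf2 f20 z1 z2 mD Drho; apply: le_trans (ineq mf1 f10 mf2 f20).
set I1 := (\int[mu]_x (f1 x)%:E)%E; set I2 := (\int[mu]_x (f2 x)%:E)%E.
have I10 : (0 <= I1)%E by apply: integral_ge0 => x _; rewrite lee_fin.
have I20 : (0 <= I2)%E by apply: integral_ge0 => x _; rewrite lee_fin.
have I0 : (0 <= I1 * I2)%E by exact: mule_ge0.
have P0 : (0 <= \int[mu]_(x in D) (N x `^ alpha)%:E)%E.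
  by apply: integral_ge0 => x _; rewrite lee_fin powR_ge0.
have -> : (I1 * I2 * (\int[mu]_(x in D) (N x `^ alpha)%:E) `^ q^-1 =
    ((I1 * I2) `^ q * \int[mu]_(x in D) (N x `^ alpha)%:E) `^ q^-1)%E.
  by rewrite poweRM ?poweR_ge0// -poweRrM mulfV ?gt_eqF// poweRe1.
apply: ge0_le_poweR; first by rewrite invr_ge0 ltW.
  by rewrite mule_ge0 ?poweR_ge0.
have mBI1 := measurable_ball_integral mN N0 Q0 b0 growth mf1 f10.
have mBI2 := measurable_ball_integral mN N0 Q0 b0 growth mf2 f20.
have mNa : measurable_fun D (fun x => (N x `^ alpha)%:E).
  exact: measurable_funTS (measurable_powR_N_EFin mN alpha).
have Na0 x : D x -> (0 <= (N x `^ alpha)%:E)%E by rewrite lee_fin powR_ge0.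
rewrite -(ge0_integralZl mu mD mNa Na0 (poweR_ge0 _ q)).
rewrite (@eq_integral _ _ _ _ D (fun x =>
   ((BI f1 (N x) * BI f2 (N x)) `^ q * (N x `^ alpha)%:E)%E)); last first.
  move=> x; rewrite inE => /Drho xr.
  by rewrite (ball_integral_full mf1 z1 xr) (ball_integral_full mf2 z2 xr).
apply: ge0_subset_integral => //.
- apply: emeasurable_funM; last exact: measurable_powR_N_EFin.
  apply: (measurableT_comp (measurable_poweR q)).
  exact: emeasurable_funM.
- by move=> x _; rewrite mule_ge0 ?poweR_ge0 ?lee_fin ?powR_ge0.
Qed.

End lower_bound.

End necessity.

Section necessary_conditions.
Context d (T : measurableType d) (R : realType).
Context (mu : {sigma_finite_measure set T -> \bar R}).
Context (N : T -> R) (Q a b : R).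
Hypothesis mN : measurable_fun setT N.
Hypothesis N0 : forall x, 0 <= N x.
Hypotheses (Q0 : 0 < Q) (a0 : 0 < a) (b0 : 0 < b).
Hypothesis growth : forall r, 0 < r ->
  ((a * r `^ Q)%:E <= mu [set x | N x < r]%R <= (b * r `^ Q)%:E)%E.
Local Notation BI := (ball_integral mu N).
Local Notation WI := (weighted_integral mu N).
Local Notation A := (annulus N).

(** The inequality is symmetric in its two functions. *)
Lemma bilinear_hardyC p1 p2 q alpha beta1 beta2 C :
  bilinear_hardy mu N p1 p2 q alpha beta1 beta2 C ->
  bilinear_hardy mu N p2 p1 q alpha beta2 beta1 C.
Proof.
move=> H f1 f2 mf1 f10 mf2 f20; have := H f2 f1 mf2 f20 mf1 f10.
rewrite -(muleA C%:E) (muleC (WI p1 beta1 f2 `^ _)%E) muleA.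
have -> : (\int[mu]_x ((BI f2 (N x) * BI f1 (N x)) `^ q * (N x `^ alpha)%:E) =
  \int[mu]_x ((BI f1 (N x) * BI f2 (N x)) `^ q * (N x `^ alpha)%:E))%E.
  by apply: eq_integral => x _; rewrite (muleC (BI f1 _)).
by [].
Qed.

(** The inequality tested on two powers of N, each restricted to an annulus. *)
Lemma bilinear_hardy_annular p1 p2 q alpha beta1 beta2 C s1 s2 r1 r2 t rho D :
  0 < q -> 0 < p1 -> 0 < p2 -> 0 < r1 -> 0 < r2 -> t <= rho ->
  bilinear_hardy mu N p1 p2 q alpha beta1 beta2 C ->
  measurable D -> (forall x, D x -> rho <= N x) ->
  ((\int[mu]_(x in A r1 t) (N x `^ s1)%:E *
    \int[mu]_(x in A r2 t) (N x `^ s2)%:E) *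
    (\int[mu]_(x in D) (N x `^ alpha)%:E) `^ (q^-1)%R
   <= C%:E * (\int[mu]_(x in A r1 t) (N x `^ (s1 * p1 + beta1))%:E) `^ (p1^-1)%R
    * (\int[mu]_(x in A r2 t) (N x `^ (s2 * p2 + beta2))%:E) `^ (p2^-1)%R)%E.
Proof.
move=> q0 p10 p20 r10 r20 trho H mD HD.
rewrite -(weighted_integral_annular_power mu N beta1 s1 t p10 r10).
rewrite -(weighted_integral_annular_power mu N beta2 s2 t p20 r20).
rewrite -(integral_annular_power mu N s1) -(integral_annular_power mu N s2).
apply: (bilinear_lower_bound mN N0 Q0 b0 growth q0 H (rho := t)) => //.
- exact: measurable_annular_power.
- by move=> x; exact: annular_power_ge0.
- exact: measurable_annular_power.
- by move=> x; exact: annular_power_ge0.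
- by move=> x; exact: annular_power_eq0.
- by move=> x; exact: annular_power_eq0.
- by move=> x /HD; exact: le_trans.
Qed.

Context (p1 p2 q alpha beta1 beta2 C : R).
Hypotheses (p11 : 1 < p1) (p20 : 0 < p2) (q0 : 0 < q) (C0 : 0 < C).
Hypothesis ineq : bilinear_hardy mu N p1 p2 q alpha beta1 beta2 C.

Let p10 : 0 < p1. Proof. exact: lt_trans p11. Qed.

Lemma integral_powR_fin gam s t : 0 < s -> exists2 v : R, 0 <= v &
  (\int[mu]_(x in A s t) (N x `^ gam)%:E = v%:E)%E.
Proof.
move=> s0; have := integral_powR_annulus_lty mN growth gam t s0.
have v0 : (0 <= \int[mu]_(x in A s t) (N x `^ gam)%:E)%E.
  by apply: integral_ge0 => x _; rewrite lee_fin powR_ge0.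
move=> vy; exists (fine (\int[mu]_(x in A s t) (N x `^ gam)%:E)%E).
  exact: fine_ge0.
by rewrite fineK// ge0_fin_numE.
Qed.

(** Testing on the indicators of the annuli r <= N < lam r, for all r > 0. *)
Lemma bilinear_hardy_homogeneity :
  2 * Q + (alpha + Q) / q = (beta1 + Q) / p1 + (beta2 + Q) / p2.
Proof.
have [lam lam1 thick] := exists_thick_annulus mN Q0 a0 b0 growth.
have lam0 : 0 < lam by exact: lt_trans lam1.
have [e e0 low] := integral_annulus_lower mN 0 lam1 thick.
have [k k0 lowk] := integral_annulus_lower mN alpha lam1 thick.
have [c1 c10 up1] := integral_annulus_upper mN b0 growth (0 * p1 + beta1) lam1.
have [c2 c20 up2] := integral_annulus_upper mN b0 growth (0 * p2 + beta2) lam1.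
apply: (@powR_le_eq_exponent R (e * e * (k * lam `^ (alpha + Q)) `^ q^-1)
  (C * c1 `^ p1^-1 * c2 `^ p2^-1)).
- by rewrite !mulr_gt0// powR_gt0// mulr_gt0// powR_gt0.
- by rewrite !mulr_gt0// powR_gt0.
move=> r r0; have lr0 : 0 < lam * r by rewrite mulr_gt0.
have := bilinear_hardy_annular 0 0 q0 p10 p20 r0 r0 (lexx (lam * r)) ineq
  (measurable_annulus mN (lam * r) (lam * (lam * r))) _.
move=> /(_ _)/wrap[]; first by move=> x /andP[].
have := low r r0; have := lowk (lam * r) lr0; have := up1 r r0;
  have := up2 r r0.
have [v1 v10 ->] := integral_powR_fin (0 * p1 + beta1) (lam * r) r0.
have [v2 v20 ->] := integral_powR_fin (0 * p2 + beta2) (lam * r) r0.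
have [w w0 ->] := integral_powR_fin 0 (lam * r) r0.
have [z z0 ->] := integral_powR_fin alpha (lam * (lam * r)) lr0.
rewrite !poweR_EFin -!EFinM !lee_fin !mul0r !add0r => H2 H1 Hz Hw H.
have -> : e * e * (k * lam `^ (alpha + Q)) `^ q^-1 *
  r `^ (2 * Q + (alpha + Q) / q) =
    (e * r `^ Q) * (e * r `^ Q) * (k * (lam * r) `^ (alpha + Q)) `^ q^-1.
  have -> : 2 * Q + (alpha + Q) / q = Q + (Q + (alpha + Q) / q) by ring.
  rewrite [r `^ (Q + (Q + _))]powRD ?(gt_eqF r0) ?implybT//.
  rewrite [r `^ (Q + _ / _)]powRD ?(gt_eqF r0) ?implybT//.
  have -> : (k * (lam * r) `^ (alpha + Q)) `^ q^-1 =
      (k * lam `^ (alpha + Q)) `^ q^-1 * r `^ ((alpha + Q) / q).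
    rewrite (powRM (alpha + Q) (ltW lam0) (ltW r0)) mulrA.
    rewrite powRM ?powR_ge0 ?mulr_ge0 ?powR_ge0 ?(ltW k0)//.
    by rewrite [X in _ = _ * X]powRrM.
  by ring.
have -> : C * c1 `^ p1^-1 * c2 `^ p2^-1 *
  r `^ ((beta1 + Q) / p1 + (beta2 + Q) / p2) =
    C * (c1 * r `^ (beta1 + Q)) `^ p1^-1 * (c2 * r `^ (beta2 + Q)) `^ p2^-1.
  rewrite [r `^ (_ / _ + _)]powRD ?(gt_eqF r0) ?implybT//.
  rewrite !powRM ?powR_ge0 ?(ltW c10) ?(ltW c20)//.
  by rewrite -!powRrM; ring.
have er0 : 0 <= e * r `^ Q by rewrite mulr_ge0 ?powR_ge0 ?(ltW e0).
apply: le_trans (le_trans H _).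
  apply: ler_pM; rewrite ?powR_ge0 ?(mulr_ge0 er0)//; first exact: ler_pM.
  apply: ge0_ler_powR; rewrite ?nnegrE ?invr_ge0 ?(ltW q0) ?mulr_ge0 ?powR_ge0
    ?(ltW k0)//.
apply: ler_pM; rewrite ?powR_ge0 ?mulr_ge0 ?powR_ge0 ?(ltW C0)//.
  apply: ler_wpM2l; first exact: ltW.
  by apply: ge0_ler_powR; rewrite ?nnegrE ?invr_ge0 ?(ltW p10) ?mulr_ge0
    ?powR_ge0 ?(ltW c10).
by apply: ge0_ler_powR; rewrite ?nnegrE ?invr_ge0 ?(ltW p20) ?mulr_ge0 ?powR_ge0
  ?(ltW c20).
Qed.

(** Otherwise, with s the number whose positivity is claimed, the test function
    N^(s - Q) on ep <= N < 1 has an integral at least L, the integral of N^(- Q)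
    there, and its weighted norm is L^(1 / p1), which is of smaller order as ep
    tends to 0. *)
Lemma bilinear_hardy_sigma_gt0 : 0 < Q - (beta1 + Q) / p1.
Proof.
rewrite ltNge; apply/negP => s0; set s := Q - (beta1 + Q) / p1 in s0.
have [lam lam1 thick] := exists_thick_annulus mN Q0 a0 b0 growth.
have lam0 : 0 < lam by exact: lt_trans lam1.
have [mlam [c [mlam1 c0 big]]] :=
  integral_annulus_powRNQ_ge mN N0 Q0 a0 b0 growth.
have mlam0 : 0 < mlam by exact: lt_trans mlam1.
have [e e0 low] := integral_annulus_lower mN 0 lam1 thick.
have [k k0 lowk] := integral_annulus_lower mN alpha lam1 thick.
have lV0 : 0 < lam^-1 by rewrite invr_gt0.
have lVE : lam * lam^-1 = 1 by rewrite mulfV// gt_eqF.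
(* The second function is the indicator of lam^-1 <= N < 1, and the left-hand
   side is restricted to 1 <= N < lam. *)
have [v2 v20 E2] := integral_powR_fin (0 * p2 + beta2) (lam * lam^-1) lV0.
have [w w0 Ew] := integral_powR_fin 0 (lam * lam^-1) lV0.
have [z z0 Ez] := integral_powR_fin alpha (lam * 1) ltr01.
pose w' := e * lam^-1 `^ (0 + Q); pose z' := k * 1 `^ (alpha + Q).
have w'0 : 0 < w' by rewrite mulr_gt0 ?powR_gt0.
have z'0 : 0 < z' by rewrite mulr_gt0 ?powR_gt0.
have ww : w' <= w by have := low _ lV0; rewrite Ew lee_fin.
have zz : z' <= z by have := lowk _ ltr01; rewrite Ez lee_fin.
pose k1 := w' * z' `^ q^-1.
have k10 : 0 < k1 by rewrite mulr_gt0 ?powR_gt0.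
pose M := C * v2 `^ p2^-1 / k1.
have M0 : 0 <= M.
  apply: divr_ge0; last exact: ltW.
  by apply: mulr_ge0; [exact: ltW|exact: powR_ge0].
pose p' := (1 - p1^-1)^-1.
have ip' : 0 < 1 - p1^-1 by rewrite subr_gt0 invf_lt1.
have p'0 : 0 < p' by rewrite invr_gt0.
(* With m thick annuli, L is too large for the bound L^(1 / p') <= M that the
   inequality gives. *)
pose m := (Num.trunc (M `^ p' / c)).+1.
have mlt : M `^ p' < m%:R * c by rewrite -ltr_pdivrMr//; exact: truncnS_gt.
pose ep := mlam ^- m.
have ep0 : 0 < ep by rewrite invr_gt0 exprn_gt0.
have [L L0 EL] := integral_powR_fin (- Q) 1 ep0.
have mL : m%:R * c <= L.
  rewrite -lee_fin -EL; have := big _ m ep0.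
  by rewrite /ep mulfV// gt_eqF// exprn_gt0.
have [J J0 EJ] := integral_powR_fin (s - Q) 1 ep0.
have LJ : L <= J.
  rewrite -lee_fin -EL -EJ; apply: ge0_le_integral => //.
  - exact: measurable_annulus.
  - by move=> x _; rewrite lee_fin powR_ge0.
  - exact: measurable_funTS (measurable_powR_N_EFin mN _).
  - exact: measurable_funTS (measurable_powR_N_EFin mN _).
  - move=> x /andP[xl xu]; rewrite lee_fin; apply: ger_powR.
      by rewrite (lt_le_trans ep0 xl) ltW.
    by rewrite gerDr.
have := bilinear_hardy_annular (s - Q) 0 q0 p10 p20 ep0 lV0 (lexx 1) ineq
  (measurable_annulus mN 1 (lam * 1)) _.
move=> /(_ _)/wrap[]; first by move=> x /andP[].
have -> : (s - Q) * p1 + beta1 = - Q by rewrite /s; field; rewrite gt_eqF.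
rewrite lVE in E2 Ew.
rewrite EJ Ew Ez EL E2 !poweR_EFin -!EFinM lee_fin => H.
have {}H : L * k1 <= C * L `^ p1^-1 * v2 `^ p2^-1.
  apply: le_trans H; rewrite -[leRHS]mulrA; apply: ler_pM => //;
    first exact: ltW.
  apply: ler_pM; rewrite ?powR_ge0 ?(ltW w'0)//.
  by apply: ge0_ler_powR; rewrite ?nnegrE ?invr_ge0 ?(ltW q0) ?(ltW z'0).
have Lp : 0 < L.
  by apply: lt_le_trans mL; rewrite mulr_gt0.
have {}H : L `^ (1 - p1^-1) <= M.
  rewrite /M ler_pdivlMr// -(ler_pM2l (powR_gt0 p1^-1 Lp)) mulrA -powRD;
    last first.
    by rewrite (gt_eqF Lp) implybT.
  rewrite addrC subrK powRr1//; apply: (le_trans H).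
  by rewrite le_eqVlt; apply/orP; left; apply/eqP; ring.
have : L <= M `^ p'.
  have -> : L = (L `^ (1 - p1^-1)) `^ p'.
    by rewrite -powRrM /p' mulfV ?gt_eqF// powRr1.
  by apply: ge0_ler_powR; rewrite ?nnegrE ?(ltW p'0) ?powR_ge0.
move=> /(le_lt_trans)/(_ mlt); rewrite ltNge => /negP; exact.
Qed.

End necessary_conditions.

(** * Complex-valued functions *)

Section complex_modulus.
Context (R : realType).
Local Open Scope complex_scope.
Local Open Scope ring_scope.
Local Notation C := (R[i] : numFieldType).

Lemma cabs_norm (z : R[i]) : `|z| = (cabs z)%:C.
Proof. by []. Qed.

Lemma cabs_ge0 (z : R[i]) : 0 <= cabs z.
Proof. by case: z => x y; exact: sqrtr_ge0. Qed.

Lemma cabs_real (x : R) : cabs x%:C = `|x|.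
Proof. by rewrite /cabs /= expr0n /= addr0 sqrtr_sqr. Qed.

Lemma cabs_continuous : continuous (fun z : C => cabs z).
Proof.
move=> z.
apply/(@cvgrPdist_lt _ _ _ (nbhs (z : C)) (nbhs_filter (z : C))) => e e0.
apply/nbhs_ballP; exists (e%:C : C); first by rewrite /= ltcR.
move=> w; rewrite -ball_normE /= => zw.
have : `| `|z| - `|w| | < e%:C :> C by exact: le_lt_trans (ler_dist_dist _ _)
  zw.
rewrite (cabs_norm z) (cabs_norm w).
have -> : (cabs z)%:C - (cabs w)%:C = (cabs z - cabs w)%:C by rewrite rmorphB.
by rewrite cabs_norm cabs_real ltcR.
Qed.

Lemma complex_continuous : continuous (fun x : R => x%:C : C).
Proof.
move=> x; apply/cvgrPdist_lt => e e0.
have eE : e = (complex.Re e)%:C by rewrite RRe_real// gtr0_real.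
have e0' : 0 < complex.Re e by move: e0; rewrite eE ltcR.
apply/nbhs_ballP; exists (complex.Re e) => //= y; rewrite /ball /= => xy.
have -> : x%:C - y%:C = (x - y)%:C by rewrite rmorphB.
by rewrite cabs_norm cabs_real eE ltcR.
Qed.

Lemma measurable_cabs n (f : 'rV[R]_n -> R[i]) : measurable_cfun f ->
  measurable_fun [set: borel 'rV[R]_n] (fun x => cabs (f x)).
Proof.
move=> mf; have mc := continuous_measurable_real cabs_continuous.
exact: measurableT_comp mc mf.
Qed.

(** A measurable real function is measurable as a complex-valued one. *)
Lemma measurable_cfun_real n (g : 'rV[R]_n -> R) :
  measurable_fun [set: borel 'rV[R]_n] g ->
  measurable_cfun (fun x => (g x)%:C).
Proof.
move=> mg; apply: (@measurability _ _ (borel 'rV[R]_n) (borel C) setT _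
  (@open C)) => //.
move=> _ [U oU <-].
have oV : open ((fun x : R => x%:C : C) @^-1` U).
  by apply: open_comp => // x _; exact: complex_continuous.
exact: (mg measurableT _ (open_measurable oV)).
Qed.

End complex_modulus.

(** * Characterization of the bilinear inequality *)

Section exponents.
Context (R : realType).

Lemma sigma_conj (p p' beta Q : R) : 0 < p -> 0 < p' -> p^-1 + p'^-1 = 1 ->
  (beta * (1 - p') + Q) / p' = Q - (beta + Q) / p.
Proof.
move=> p0 p'0 pp'; have -> : p^-1 = 1 - p'^-1 by rewrite -pp' addrK.
by field; rewrite gt_eqF.
Qed.

Lemma conj_gt0 (p p' : R) : 1 < p -> p^-1 + p'^-1 = 1 -> 0 < p'.
Proof.
move=> p1 pp'; rewrite -invr_gt0.
have -> : p'^-1 = 1 - p^-1 by rewrite -pp' addrAC subrr add0r.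
by rewrite subr_gt0 invf_lt1// (lt_trans _ p1).
Qed.

(** The condition involving r2 in the theorem is a rewriting of t + s_2 < 0,
    where A = alpha + Q and g2 = beta_2 (1 - p_2') + Q. *)
Lemma exponent_condition (q q' p2 p2' r2 A g2 : R) :
    0 < q -> 0 < p2 -> q < p2 -> 0 < p2' -> q^-1 + q'^-1 = 1 ->
    p2^-1 + p2'^-1 = 1 -> r2^-1 = q^-1 - p2^-1 ->
  (A * r2 / q + g2 * r2 / q' + g2 < 0) = (A / q + g2 / p2' < 0).
Proof.
move=> q0 p20 qp2 p2'0 qq' pp' hr2.
have r20 : 0 < r2 by rewrite -invr_gt0 hr2 subr_gt0 ltf_pV2.
have iq' : q'^-1 = 1 - q^-1 by rewrite -qq' addrAC subrr add0r.
have ip2' : p2'^-1 = 1 - p2^-1 by rewrite -pp' addrAC subrr add0r.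
have -> : A * r2 / q + g2 * r2 / q' + g2 = r2 * (A / q + g2 / p2').
  have E : r2 * (q^-1 - p2^-1) = 1 by rewrite -hr2 mulfV// gt_eqF.
  have {2}-> : g2 = g2 * (r2 * (q^-1 - p2^-1)) by rewrite E mulr1.
  by rewrite iq' ip2'; ring.
by rewrite pmulr_rlt0.
Qed.

End exponents.

Section sigma_finite_copy.
Context d (T : measurableType d) (R : realType)
  (mu : {measure set T -> \bar R}).
Context (sf : sigma_finite [set: T] mu).

(** The measure mu itself, under a name to which its sigma-finiteness can be
    attached as an instance. *)
Definition sigma_finite_copy : set T -> \bar R := let _ := sf in mu.

HB.instance Definition _ := Measure.copy sigma_finite_copy mu.

HB.instance Definition _ :=
  Measure_isSigmaFinite.Build d T R sigma_finite_copy sf.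

End sigma_finite_copy.

Theorem corollary5p2 (R : realType) (n : nat) (n_gt0 : (0 < n)%N)
    (G : homogeneous_group R n) (N : 'rV[R]_n -> R) (hN : quasi_norm G N)
    (mu : {measure set (borel 'rV[R]_n) -> \bar R}) (hmu : haar_measure G mu)
    (Q : R) (hQ : Q = homogeneous_dim G)
    (p1 p2 q p1' p2' q' r2 alpha beta1 beta2 : R)
    (hp1 : 1 < p1) (hp2 : 1 < p2) (hq : 1 < q)
    (hp1q : p1 <= q) (hqp2 : q < p2)
    (hp1' : p1^-1 + p1'^-1 = 1) (hp2' : p2^-1 + p2'^-1 = 1)
    (hq' : q^-1 + q'^-1 = 1) (hr2 : r2^-1 = q^-1 - p2^-1) :
  (exists2 C : R, 0 < C &
    forall f1 f2 : 'rV[R]_n -> R[i],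
      measurable_cfun f1 -> measurable_cfun f2 ->
      ((\int[mu]_x ((H2B mu N (fun y => cabs (f1 y)) (fun y => cabs (f2 y)) x)
                      `^ q * (N x `^ alpha)%:E)) `^ (q^-1)%R
       <= C%:E
          * (\int[mu]_x (cabs (f1 x) `^ p1 * N x `^ beta1)%:E) `^ (p1^-1)%R
          * (\int[mu]_x (cabs (f2 x) `^ p2 * N x `^ beta2)%:E) `^ (p2^-1)%R)%E)
  <->
  [/\ [/\ beta1 * (1 - p1') + Q > 0, alpha + Q < 0
        & beta2 * (1 - p2') + Q > 0],
      (alpha + Q) * r2 / q + (beta2 * (1 - p2') + Q) * r2 / q'
        + (beta2 * (1 - p2') + Q) < 0
    & (alpha + Q) / q + (beta1 * (1 - p1') + Q) / p1'
        + (beta2 * (1 - p2') + Q) / p2' = 0].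
Proof.
have p10 : 0 < p1 by exact: lt_trans hp1.
have p20 : 0 < p2 by exact: lt_trans hp2.
have q0 : 0 < q by exact: lt_trans hq.
have p1'0 := conj_gt0 hp1 hp1'; have p2'0 := conj_gt0 hp2 hp2'.
have Q0 : 0 < Q by rewrite hQ homogeneous_dim_gt0.
have mN := measurable_qnorm hN.
have N0 := qnorm_ge0 hN.
have [a [b [a0 b0 growth]]] := ball_growth hmu hN.
rewrite -hQ in growth.
have sf : sigma_finite [set: borel 'rV[R]_n] mu.
  exists (fun k => [set x : borel 'rV[R]_n | N x < k%:R]).
    apply/seteqP; split => // x _; exists (Num.trunc (N x)).+1 => //=.
    exact: truncnS_gt.
  move=> k; split; first exact: measurable_sublevel.
  exact: mu_sublevel_lty mN growth _.
pose smu : {sigma_finite_measure set (borel 'rV[R]_n) -> \bar R} :=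
  sigma_finite_copy sf.
have sgrowth r : 0 < r ->
    ((a * r `^ Q)%:E <= smu [set x | (N x < r)%R] <= (b * r `^ Q)%:E)%E.
  exact: growth.
split=> [[C C0 HC]|[[g1 aQ g2] _ balance]].
  have ineq : bilinear_hardy smu N p1 p2 q alpha beta1 beta2 C.
    pose ineq_for (g1 g2 : 'rV[R]_n -> R) :=
      ((\int[smu]_x ((ball_integral smu N g1 (N x) *
        ball_integral smu N g2 (N x))
          `^ q * (N x `^ alpha)%:E)) `^ (q^-1)%R
       <= C%:E * (weighted_integral smu N p1 beta1 g1) `^ (p1^-1)%R
               * (weighted_integral smu N p2 beta2 g2) `^ (p2^-1)%R)%E.
    (* A nonnegative real function is its own modulus. *)
    have cE (f : 'rV[R]_n -> R) : (forall x, 0 <= f x) ->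
        (fun y => cabs (real_complex R (f y))) = f.
      by move=> f0; apply/funext => y; rewrite cabs_real ger0_norm.
    move=> f1 f2 mf1 f10 mf2 f20.
    have : ineq_for (fun y => cabs (real_complex R (f1 y)))
                    (fun y => cabs (real_complex R (f2 y))).
      exact: HC (measurable_cfun_real mf1) (measurable_cfun_real mf2).
    by rewrite (cE f1 f10) (cE f2 f20).
  have s1 := bilinear_hardy_sigma_gt0 mN N0 Q0 a0 b0 sgrowth hp1 p20 q0 C0 ineq.
  have s2 := bilinear_hardy_sigma_gt0 mN N0 Q0 a0 b0 sgrowth hp2 p10 q0 C0
    (bilinear_hardyC ineq).
  have hom := bilinear_hardy_homogeneity mN N0 Q0 a0 b0 sgrowth hp1 p20 q0 C0
    ineq.
  have e1 := sigma_conj beta1 Q p10 p1'0 hp1'.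
  have e2 := sigma_conj beta2 Q p20 p2'0 hp2'.
  have balance : (alpha + Q) / q + (beta1 * (1 - p1') + Q) / p1'
      + (beta2 * (1 - p2') + Q) / p2' = 0.
    rewrite e1 e2; move: hom.
    move: ((alpha + Q) / q) ((beta1 + Q) / p1) ((beta2 + Q) / p2) => X Y Z; lra.
  split => //.
    split.
    - by move: s1; rewrite -e1 pmulr_lgt0 ?invr_gt0.
    - have : (alpha + Q) / q < 0.
        move: balance s1 s2; rewrite -e1 -e2.
        move: ((alpha + Q) / q) (_ / p1') (_ / p2') => X Y Z; lra.
      by rewrite pmulr_llt0 ?invr_gt0.
    - by move: s2; rewrite -e2 pmulr_lgt0 ?invr_gt0.
  rewrite (exponent_condition _ _ q0 p20 hqp2 p2'0 hq' hp2' hr2).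
  move: balance s1; rewrite -e1.
  move: ((alpha + Q) / q) (_ / p1') (_ / p2') => X Y Z; lra.
have [C C0 HC] := bilinear_sufficient (mu := smu) mN N0 Q0 b0 sgrowth p10 p1'0
  hp1' p20 p2'0
  hp2' hp1q g1 g2 balance.
exists C => // f1 f2 mf1 mf2.
exact: (HC _ _ (measurable_cabs mf1) (fun=> cabs_ge0 _) (measurable_cabs mf2)
  (fun=> cabs_ge0 _)).
Qed.
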